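(* Let $G$ be a finite group, let $U$ and $U'$ be projective unitary representations of $G$ on finite-dimensional Hilbert spaces $\mathcal{H}$ and $\mathcal{H}'$, respectively, let $\rho\in\mathcal{S}(\mathcal{H})$, $\sigma\in\mathcal{S}(\mathcal{H}')$, let $H$ and $H'$ be Hermitian operators (Hamiltonians) on $\mathcal{H}$ and $\mathcal{H}'$, and suppose $U$ and $U'$ commute with $H$ and $H'$, respectively. Fix an inverse temperature $\beta>0$. Then $$R_{G\text{-}\mathrm{cov},\mathrm{TCGP}}(\rho\to\sigma)=\begin{cases}R_{\mathrm{TCGP}}(\rho\to\sigma)&\text{if the compatibility condition holds,}\\0&\text{otherwise,}\end{cases}$$ where the compatibility condition is: for every $g\in G$ and every real sequence $(t_j)_{j\in\mathbb{N}}$ with $\lim_{j\to\infty}e^{-it_jH}\rho e^{it_jH}=U(g)\rho U(g)^\dagger$, one has $\lim_{j\to\infty}e^{-it_jH'}\sigma e^{it_jH'}=U'(g)\sigma U'(g)^\dagger$.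
   Context: $\mathcal{S}(\mathcal{H})$ denotes density operators on $\mathcal{H}$. On $n$ copies the Hamiltonian is $H^{(n)}=\sum_{j=1}^nI^{\otimes j-1}\otimes H\otimes I^{\otimes n-j}$ and the representation is $U(g)^{\otimes n}$ (similarly for the output). TCGP (time-translation-covariant Gibbs-preserving) operations are channels $\mathcal{E}$ from a system with Hamiltonian $H_1$ to a system with Hamiltonian $H_2$ that map the Gibbs state $e^{-\beta H_1}/\mathrm{tr}(e^{-\beta H_1})$ to $e^{-\beta H_2}/\mathrm{tr}(e^{-\beta H_2})$ and satisfy $\mathcal{E}(e^{-itH_1}Le^{itH_1})=e^{-itH_2}\mathcal{E}(L)e^{itH_2}$ for all $L$ and $t\in\mathbb{R}$. A channel is $G$-covariant if it intertwines the conjugation actions of $G$ on input and output. For a class $\mathcal{O}$ of channels, $R_{\mathcal{O}}(\rho\to\sigma)$ is the supremum of all $r\ge0$ for which there are $\mathcal{E}^{(n)}\in\mathcal{O}$ from $n$ input copies to $\lfloor rn\rfloor$ output copies with $\frac12\|\mathcal{E}^{(n)}(\rho^{\otimes n})-\sigma^{\otimes\lfloor rn\rfloor}\|_1\to0$. $R_{\mathrm{TCGP}}$ and $R_{G\text{-}\mathrm{cov},\mathrm{TCGP}}$ are the rates for TCGP operations and for $G$-covariant TCGP operations. *)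

(* Defs.v *)
From HB Require Import structures.
From mathcomp Require Import all_boot all_order all_algebra all_fingroup.
From mathcomp Require Import sesquilinear spectral complex.
From mathcomp Require mxtens.
From mathcomp Require Import all_classical all_reals all_analysis.
Set Implicit Arguments.
Unset Strict Implicit.
Unset Printing Implicit Defensive.
Import Order.TTheory GRing.Theory Num.Theory.
Import numFieldNormedType.Exports.
Import mxtens(tensmx, ntensmx).
Local Open Scope classical_set_scope.
Local Open Scope ring_scope.
Local Open Scope sesquilinear_scope.

(* The complex numbers over R.  Naming the bundled [numClosedFieldType] gives
   matrices over it the topology that the library puts on every
   [numClosedFieldType]; the bare type [R[i]] carries no such instance. *)
Definition Cx (R : realType) : numClosedFieldType := R[i].
Arguments Cx : simpl never.

Definition rc (R : realType) (x : R) : Cx R := (x%:C)%C.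

(* A Hilbert space of dimension d is 'cV[Cx R]_d, with operators 'M[Cx R]_d. *)

(* In the order on complex numbers, [0 <= z] says that z is real and
   nonnegative, so a psd matrix is in particular Hermitian. *)
Definition psd (R : realType) (d : nat) (A : 'M[Cx R]_d) : Prop :=
  forall v : 'cV[Cx R]_d, 0 <= (v ^t* *m A *m v) 0 0.

Definition density (R : realType) (d : nat) (A : 'M[Cx R]_d) : Prop :=
  psd A /\ \tr A = 1.

Definition expmx (R : realType) (d : nat) (A : 'M[Cx R]_d) : 'M[Cx R]_d :=
  lim (series (fun k : nat => (k`!%:R : Cx R)^-1 *: A ^+ k) @ \oo).

Definition evol (R : realType) (d : nat) (H : 'M[Cx R]_d) (t : R)
    (L : 'M[Cx R]_d) : 'M[Cx R]_d :=
  expmx (- ('i * rc t) *: H) *m L *m expmx (('i * rc t) *: H).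

Definition gibbs (R : realType) (d : nat) (beta : R) (H : 'M[Cx R]_d) :
    'M[Cx R]_d :=
  (\tr (expmx (- rc beta *: H)))^-1 *: expmx (- rc beta *: H).

(* tr (sqrt (A^* A)): the sum of the square roots of the eigenvalues, counted
   with multiplicity, of the Hermitian matrix A^* A. *)
Definition trace_norm (R : realType) (d : nat) (A : 'M[Cx R]_d) : R :=
  \sum_(i < d) Num.sqrt (complex.Re (spectral_diag (A ^t* *m A) 0 i)).

Definition proj_urep (R : realType) (G : finGroupType) (d : nat)
    (U : G -> 'M[Cx R]_d) : Prop :=
  (forall g, U g \is unitarymx) /\
  (forall g h, exists c : Cx R, `|c| = 1 /\ U g *m U h = c *: U (g * h)%g).

(* A_0 (x) A_1 (x) ... (x) A_(n-1), with the same dimension d ^ n and the same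
   bracketing as the tensor power [ntensmx]; the empty product is the scalar 1,
   acting on the one-dimensional space. *)
Fixpoint tens_family_rec (R : realType) (d : nat) (A : nat -> 'M[Cx R]_d)
    (k : nat) : 'M[Cx R]_(d ^ k.+1) :=
  if k is k'.+1 then tensmx (A 0%N) (tens_family_rec (fun i => A i.+1) k')
  else A 0%N.

Definition tens_family (R : realType) (d : nat) (A : nat -> 'M[Cx R]_d)
    (n : nat) : 'M[Cx R]_(d ^ n) :=
  if n is k.+1 return 'M[Cx R]_(d ^ n) then tens_family_rec A k else 1.

Lemma tens_family_cst (R : realType) (d : nat) (A : 'M[Cx R]_d) (n : nat) :
  tens_family (fun=> A) n = ntensmx A n.
Proof. by case: n => // k; rewrite /ntensmx /=; elim: k => //= k ->. Qed.

Definition hamn (R : realType) (d : nat) (H : 'M[Cx R]_d) (n : nat) :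
    'M[Cx R]_(d ^ n) :=
  \sum_(j < n) tens_family (fun i => if i == j :> nat then H else 1%:M) n.

Definition block (R : realType) (k m : nat) (X : 'M[Cx R]_(k * m))
    (i j : 'I_k) : 'M[Cx R]_m :=
  \matrix_(r, s) X (mxtens.mxtens_index (i, r)) (mxtens.mxtens_index (j, s)).

(* (id_k (x) E)(X) = sum_(i, j) e_ij (x) E(X_ij), where X = sum e_ij (x) X_ij. *)
Definition ampl (R : realType) (k m n : nat) (E : 'M[Cx R]_m -> 'M[Cx R]_n)
    (X : 'M[Cx R]_(k * m)) : 'M[Cx R]_(k * n) :=
  \sum_(i < k) \sum_(j < k) tensmx (delta_mx i j) (E (block X i j)).

Definition channel (R : realType) (m n : nat)
    (E : {linear 'M[Cx R]_m -> 'M[Cx R]_n}) : Prop :=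
  (forall (k : nat) (X : 'M[Cx R]_(k * m)), psd X -> psd (ampl E X)) /\
  (forall X, \tr (E X) = \tr X).

Definition tcgp (R : realType) (m n : nat) (beta : R)
    (H1 : 'M[Cx R]_m) (H2 : 'M[Cx R]_n)
    (E : {linear 'M[Cx R]_m -> 'M[Cx R]_n}) : Prop :=
  [/\ channel E, E (gibbs beta H1) = gibbs beta H2
    & forall (L : 'M[Cx R]_m) (t : R), E (evol H1 t L) = evol H2 t (E L)].

Definition covariant (R : realType) (G : finGroupType) (m n : nat)
    (V : G -> 'M[Cx R]_m) (V' : G -> 'M[Cx R]_n)
    (E : {linear 'M[Cx R]_m -> 'M[Cx R]_n}) : Prop :=
  forall (g : G) (X : 'M[Cx R]_m),
    E (V g *m X *m (V g) ^t*) = V' g *m E X *m (V' g) ^t*.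

(* A class of operations from n copies of a d-dimensional system to m copies of
   a d'-dimensional one, for all n and m. *)
Definition op_class (R : realType) (d d' : nat) : Type :=
  forall n m : nat, {linear 'M[Cx R]_(d ^ n) -> 'M[Cx R]_(d' ^ m)} -> Prop.

(* [Num.truncn x] is the floor of x >= 0 as a natural number. *)
Definition achievable (R : realType) (d d' : nat) (O : op_class R d d')
    (rho : 'M[Cx R]_d) (sigma : 'M[Cx R]_d') (r : R) : Prop :=
  0 <= r /\
  exists E : forall n : nat,
      {linear 'M[Cx R]_(d ^ n) -> 'M[Cx R]_(d' ^ (Num.truncn (r * n%:R)))},
    (forall n : nat, O n (Num.truncn (r * n%:R)) (E n)) /\
    (fun n : nat => 2^-1 * trace_norm
       (E n (ntensmx rho n) - ntensmx sigma (Num.truncn (r * n%:R))))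
      @ \oo --> (0 : R).

Definition rate (R : realType) (d d' : nat) (O : op_class R d d')
    (rho : 'M[Cx R]_d) (sigma : 'M[Cx R]_d') : \bar R :=
  ereal_sup [set r%:E | r in [set r : R | achievable O rho sigma r]].

Definition tcgp_class (R : realType) (d d' : nat) (beta : R)
    (H : 'M[Cx R]_d) (H' : 'M[Cx R]_d') : op_class R d d' :=
  fun n m E => tcgp beta (hamn H n) (hamn H' m) E.

Definition cov_tcgp_class (R : realType) (G : finGroupType) (d d' : nat)
    (beta : R) (H : 'M[Cx R]_d) (H' : 'M[Cx R]_d')
    (U : G -> 'M[Cx R]_d) (U' : G -> 'M[Cx R]_d') : op_class R d d' :=
  fun n m E => tcgp beta (hamn H n) (hamn H' m) E /\
    covariant (fun g => ntensmx (U g) n) (fun g => ntensmx (U' g) m) E.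

Definition compatible (R : realType) (G : finGroupType) (d d' : nat)
    (H : 'M[Cx R]_d) (H' : 'M[Cx R]_d')
    (U : G -> 'M[Cx R]_d) (U' : G -> 'M[Cx R]_d')
    (rho : 'M[Cx R]_d) (sigma : 'M[Cx R]_d') : Prop :=
  forall (g : G) (t : nat -> R),
    (fun j => evol H (t j) rho) @ \oo --> U g *m rho *m (U g) ^t* ->
    (fun j => evol H' (t j) sigma) @ \oo --> U' g *m sigma *m (U' g) ^t*.

(* Main.v *)
Require Import Defs.
From HB Require Import structures.
From mathcomp Require Import all_boot all_order all_algebra all_fingroup.
From mathcomp Require Import sesquilinear spectral complex.
From mathcomp Require mxtens.
From mathcomp Require Import all_classical all_reals all_analysis.
From mathcomp Require Import ring lra.
Set Implicit Arguments.
Unset Strict Implicit.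
Unset Printing Implicit Defensive.
Import Order.TTheory GRing.Theory Num.Theory.
Import numFieldNormedType.Exports.
Import mxtens.
Local Open Scope classical_set_scope.
Local Open Scope ring_scope.
Local Open Scope sesquilinear_scope.
Local Notation "A *t B" := (tensmx A B).

                                       

(** Covariant TCGP operations are TCGP operations, so one inequality between the rates is immediate,
    and rate 0 is always achieved by discarding the input and preparing the Gibbs state
    ([achievable0]). Two facts remain.

    Necessity, [achievable_compatible]: let covariant operations E work at a positive rate and let
    e^{-i t_j H} rho e^{i t_j H} tend to U(g) rho U(g)^dagger. For late j the input translated by
    t_j is close to the input rotated by g; by both covariances the two actions nearly agree on
    E(rho^n), hence, up to the conversion error, on the copies of sigma. Looking at one output copy,
    with error tending to 0, gives the limit that compatibility asks for.

    Sufficiency, [achievable_lt]: assume compatibility and a TCGP protocol of rate r, and let r' <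
    r. Only a fraction of about r'/r of the n inputs has to be converted; the others are measured to
    guess a group element. [twirled_channel] measures a POVM (M_g) on them, applies U(g) to the
    copies to be converted, runs the protocol, discards surplus outputs and applies U'(g)^dagger. If
    the POVM is covariant and commutes with the Hamiltonian, the result is TCGP and exactly
    G-covariant. Outcome g is harmless when U(g) rho U(g)^dagger lies in the closure of the time
    orbit of rho: by compatibility and time covariance this branch outputs sigma with no extra error
    ([reachable_branch_close]). So the POVM only has to make the other outcomes improbable
    ([povm_exists]).

    Such a POVM comes from pinching. For unreachable g the overlap of U(g) rho U(g)^dagger with
    every time translate of rho is at most some x < tr rho^2 ([unreachable_overlap]). Let T be the
    k-th tensor power of rho, pinched to the eigenspaces of the Hamiltonian. Being an average of
    time translates, T has expectation at most x^k in the rotated copies; as there are at most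
    (k+1)^d energies, the pinching inequality gives it expectation at least (tr rho^2)^k / (k+1)^d
    in the copies of rho ([invariant_test]). For suitable k the ratio is as small as desired.
    Rotating T over G and rescaling yields a measurement that is rarely wrong compared with its
    success probability, and repeating it on fresh copies until it succeeds makes the total error
    small ([povm_round]). *)

(** * The embedding of the reals into the complex numbers *)

Section Rc.
Variable R : realType.
Local Notation C := (Cx R).

Lemma rc_ge0 (x : R) : (0 <= rc x) = (0 <= x).
Proof. by rewrite /rc ler0c. Qed.

Lemma rc_conj (x : R) : (rc x)^* = rc x.
Proof. by rewrite /Num.conj /rc /= oppr0. Qed.

Lemma rcM (x y : R) : rc (x * y) = rc x * rc y.
Proof. exact: (rmorphM (real_complex R)). Qed.

Lemma rcD (x y : R) : rc (x + y) = rc x + rc y.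
Proof. exact: (rmorphD (real_complex R)). Qed.

Lemma rcN (x : R) : rc (- x) = - rc x.
Proof. exact: (rmorphN (real_complex R)). Qed.

Lemma rcB (x y : R) : rc (x - y) = rc x - rc y.
Proof. by rewrite rcD rcN. Qed.

Lemma rc0 : rc 0 = 0 :> C.
Proof. by []. Qed.

Lemma rc1 : rc 1 = 1 :> C.
Proof. by []. Qed.

Lemma rcX (x : R) n : rc (x ^+ n) = rc x ^+ n.
Proof. exact: (rmorphXn (real_complex R)). Qed.

Lemma rc_nat n : rc n%:R = n%:R :> C.
Proof. exact: (rmorph_nat (real_complex R)). Qed.

Lemma rc_inj : injective (@rc R).
Proof. by move=> x y []. Qed.

Lemma rc_sum (I : Type) (r : seq I) (P : pred I) (F : I -> R) :
  rc (\sum_(i <- r | P i) F i) = \sum_(i <- r | P i) rc (F i).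
Proof. exact: (rmorph_sum (real_complex R)). Qed.

Lemma rc_le (x y : R) : (rc x <= rc y) = (x <= y).
Proof. by rewrite -subr_ge0 -rcB rc_ge0 subr_ge0. Qed.

Lemma rc_lt (x y : R) : (rc x < rc y) = (x < y).
Proof. by rewrite !lt_neqAle rc_le (inj_eq rc_inj). Qed.

Lemma rcV (x : R) : rc x^-1 = (rc x)^-1.
Proof.
have [->|x0] := eqVneq x 0; first by rewrite !invr0.
apply: (mulfI (x := rc x)); first by rewrite -rc0 (inj_eq rc_inj).
by rewrite -rcM !divff // -rc0 (inj_eq rc_inj).
Qed.

Lemma rc_norm (x : R) : `|rc x| = rc `|x|.
Proof.
case: (lerP 0 x) => x0; first by rewrite !ger0_norm ?rc_ge0.
by rewrite !ltr0_norm // ?rcN // -rc0 rc_lt.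
Qed.

Lemma rc_Re (z : C) : 0 <= z -> z = rc (complex.Re z).
Proof. by case: z => a b; rewrite /rc lecE /= => /andP[/eqP -> _]. Qed.

Lemma normCx_rc (z : C) : exists2 e : R, 0 <= e & `|z| = rc e.
Proof.
have h := rc_Re (normr_ge0 z).
by exists (complex.Re `|z|) => //; rewrite -rc_ge0 -h.
Qed.

Lemma real_rc (z : C) : z \is Num.real -> z = rc (complex.Re z).
Proof. by rewrite /rc; case: z => a b; rewrite complex_real => /= /eqP ->. Qed.

End Rc.

Opaque Cx rc.

(** * Adjoints, unitaries and matrix units *)

Section Adjoint.
Variable C : numClosedFieldType.

Lemma adjM m n p (A : 'M[C]_(m, n)) (B : 'M[C]_(n, p)) :
  (A *m B)^t* = B^t* *m A^t*.
Proof. by rewrite trmx_mul map_mxM. Qed.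

Lemma trC m n (A : 'M[C]_(m, n)) (B : 'M[C]_(n, m)) : \tr (A *m B) = \tr (B *m A).
Proof. exact: mxtrace_mulC. Qed.

Lemma tensM m n p q r s (A : 'M[C]_(m, n)) (B : 'M[C]_(p, q))
    (D : 'M[C]_(n, r)) (E : 'M[C]_(q, s)) :
  (A *t B) *m (D *t E) = (A *m D) *t (B *m E).
Proof. exact: tensmx_mul. Qed.

Lemma adjE m n (A : 'M[C]_(m, n)) i j : (A^t*) i j = (A j i)^*.
Proof. by rewrite !mxE. Qed.

Lemma map_conjE m n (A : 'M[C]_(m, n)) i j : (map_mx Num.conj A) i j = (A i j)^*.
Proof. by rewrite mxE. Qed.

Lemma adjD m n (A B : 'M[C]_(m, n)) : (A + B)^t* = A^t* + B^t*.
Proof. by apply/matrixP => i j; rewrite !mxE rmorphD. Qed.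

Lemma adjB m n (A B : 'M[C]_(m, n)) : (A - B)^t* = A^t* - B^t*.
Proof. by apply/matrixP => i j; rewrite !mxE rmorphB. Qed.

Lemma adjZ m n (c : C) (A : 'M[C]_(m, n)) : (c *: A)^t* = c^* *: A^t*.
Proof. by apply/matrixP => i j; rewrite !mxE rmorphM. Qed.

Lemma adj1 n : (1%:M : 'M[C]_n)^t* = 1%:M.
Proof. by rewrite trmx1 map_mx1. Qed.

Lemma adj_delta m n (i : 'I_m) (j : 'I_n) :
  (delta_mx i j : 'M[C]_(m, n))^t* = delta_mx j i.
Proof. by rewrite trmx_delta map_delta_mx. Qed.

Lemma adj_tens m n p q (A : 'M[C]_(m, n)) (B : 'M[C]_(p, q)) :
  (A *t B)^t* = A^t* *t B^t*.
Proof. by rewrite trmx_tens; exact: map_mxT. Qed.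

Lemma adj_sum (I : Type) (r : seq I) (P : pred I) m n (F : I -> 'M[C]_(m, n)) :
  (\sum_(i <- r | P i) F i)^t* = \sum_(i <- r | P i) (F i)^t*.
Proof.
by apply: (big_morph (fun X : 'M[C]_(m, n) => X^t*) (@adjD m n)); 
  rewrite trmx0 map_mx0.
Qed.

Lemma mul_adj_unitary n (P : 'M[C]_n) : P \is unitarymx -> P *m P^t* = 1%:M.
Proof. by move/unitarymxP. Qed.

Lemma adj_mul_unitary n (P : 'M[C]_n) : P \is unitarymx -> P^t* *m P = 1%:M.
Proof. by move=> uP; rewrite -(invmx_unitary uP) mulVmx // unitarymx_unit. Qed.

Lemma delta_mul_mx m n p (i : 'I_m) (j : 'I_n) (A : 'M[C]_(n, p)) k l :
  (delta_mx i j *m A) k l = (k == i)%:R * A j l.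
Proof.
rewrite mxE (bigD1 j) //= big1 ?addr0 => [|a /negPf aj]; last by rewrite mxE aj andbF mul0r.
by rewrite mxE eqxx andbT.
Qed.

Lemma mul_mx_delta m n p (i : 'I_n) (j : 'I_p) (A : 'M[C]_(m, n)) k l :
  (A *m delta_mx i j) k l = A k i * (l == j)%:R.
Proof.
rewrite mxE (bigD1 i) //= big1 ?addr0 => [|a /negPf ai]; last by rewrite mxE ai mulr0.
by rewrite mxE eqxx.
Qed.

Lemma tr_mul_delta n (A : 'M[C]_n) i j : \tr (delta_mx i j *m A) = A j i.
Proof.
rewrite /mxtrace (bigD1 i) //= big1 ?addr0 => [|a /negPf ai].
  by rewrite delta_mul_mx eqxx mul1r.
by rewrite delta_mul_mx ai mul0r.
Qed.

Lemma delta_mx_form n (A : 'M[C]_n) i j :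
  delta_mx (0 : 'I_1) i *m A *m delta_mx j (0 : 'I_1) = (A i j)%:M.
Proof.
apply/matrixP=> a b; rewrite !ord1 mul_mx_delta delta_mul_mx.
by rewrite !mxE !eqxx mul1r mulr1.
Qed.

(** Polarization: the form at e_i + c e_j with c = 0, 1, i gives the diagonal entries, then the sum
    and the difference of the two off-diagonal ones. *)
Lemma quadform_eq0 n (A : 'M[C]_n) :
  (forall v : 'cV[C]_n, (v^t* *m A *m v) 0 0 = 0) -> A = 0.
Proof.
move=> A0; apply/matrixP => i j; rewrite mxE.
have F (c : C) : A i i + c * A i j + (c^* * A j i + c^* * c * A j j) = 0.
  have := A0 (delta_mx i 0 + c *: delta_mx j 0).
  rewrite adjD adjZ !adj_delta !mulmxDl !mulmxDr -!scalemxAl -!scalemxAr.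
  by rewrite !delta_mx_form !mxE /= !mulr1n mulrA.
have Aii : A i i = 0 by have := F 0; rewrite rmorph0 !mul0r !addr0.
have Ajj : A j j = 0.
  have := A0 (delta_mx j 0); rewrite adj_delta delta_mx_form mxE eqxx.
  by rewrite mulr1n.
have := F 1; have := F 'i.
rewrite Aii Ajj !mulr0 !addr0 !add0r rmorph1 !mul1r conjCi mulNr.
move=> /eqP; rewrite subr_eq0 => /eqP /(mulfI (neq0Ci _)) e.
rewrite -e => /eqP; rewrite -mulr2n mulrn_eq0 /= => /eqP //.
Qed.

End Adjoint.

(** * Positive semidefinite matrices *)

Section Psd.
Variable R : realType.
Local Notation C := (Cx R).

Lemma psd_form n (A : 'M[C]_n) : psd A ->
  forall v : 'cV[C]_n, 0 <= (v^t* *m A *m v) 0 0.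
Proof. exact. Qed.

Lemma psd_gram p n (B : 'M[C]_(p, n)) : psd (B^t* *m B).
Proof.
move=> v; rewrite !mulmxA -mulmxA -adjM mxE sumr_ge0 // => i _.
by rewrite adjE mulrC mul_conjC_ge0.
Qed.

Lemma psd_conj p n (K : 'M[C]_(p, n)) (A : 'M[C]_n) :
  psd A -> psd (K *m A *m K^t*).
Proof.
by move=> pA v; have := pA (K^t* *m v); rewrite adjM trmxCK !mulmxA.
Qed.

Lemma psdD n (A B : 'M[C]_n) : psd A -> psd B -> psd (A + B).
Proof. by move=> pA pB v; rewrite mulmxDr mulmxDl mxE addr_ge0 ?pA ?pB. Qed.

Lemma psdZ n (c : C) (A : 'M[C]_n) : 0 <= c -> psd A -> psd (c *: A).
Proof.
by move=> c0 pA v; rewrite -scalemxAr -scalemxAl mxE mulr_ge0 ?pA.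
Qed.

Lemma psd0 n : psd (0 : 'M[C]_n).
Proof. by move=> v; rewrite mulmx0 mul0mx mxE. Qed.

Lemma psd1 n : psd (1%:M : 'M[C]_n).
Proof. by rewrite -[1%:M]mulmx1 -{1}adj1; exact: psd_gram. Qed.

Lemma psd_sum (I : Type) (r : seq I) (P : pred I) n (F : I -> 'M[C]_n) :
  (forall i, P i -> psd (F i)) -> psd (\sum_(i <- r | P i) F i).
Proof. move=> h; elim/big_rec: _ => [|i x Pi px]; first exact: psd0.
exact: psdD (h _ Pi) px. Qed.

(** Since [0 <= z] includes that z is real, [A] and its adjoint have the same quadratic form. *)
Lemma psd_adj n (A : 'M[C]_n) : psd A -> A^t* = A.
Proof.
move=> pA; apply/eqP; rewrite eq_sym -subr_eq0; apply/eqP/quadform_eq0 => v.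
rewrite mulmxBr mulmxBl mxE [X in _ + X]mxE.
have -> : v^t* *m A^t* *m v = (v^t* *m A *m v)^t*.
  by rewrite !adjM trmxCK mulmxA.
by rewrite adjE; have /CrealP -> := ger0_real (pA v); rewrite subrr.
Qed.

Lemma herm_adj n (A : 'M[C]_n) : (A \is hermsymmx) = (A^t* == A).
Proof. apply/idP/eqP => [/is_hermitianmxP|hA]; first by rewrite expr0 scale1r => <-.
by apply/is_hermitianmxP; rewrite expr0 scale1r hA. Qed.

Lemma herm_diag n (A : 'M[C]_n) : A^t* = A ->
  exists P : 'M[C]_n, exists l : 'I_n -> R,
    P \is unitarymx /\ A = P^t* *m diag_mx (\row_i rc (l i)) *m P.
Proof.
move=> /eqP; rewrite -herm_adj => hA.
have /hermitian_normalmx /orthomx_spectralP A_eq := hA.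
exists (spectralmx A), (fun i => complex.Re (spectral_diag A 0 i)).
have uP := spectral_unitarymx A; split=> //.
rewrite -(invmx_unitary uP) [LHS]A_eq; congr (_ *m diag_mx _ *m _).
apply/rowP => i; rewrite mxE.
have /mxOverP /(_ 0 i) := hermitian_spectral_diag_real hA.
by move/real_rc.
Qed.

Lemma diag_form n (A : 'M[C]_n) i :
  (delta_mx i (0 : 'I_1) : 'cV[C]_n)^t* *m A *m delta_mx i 0 = (A i i)%:M.
Proof. by rewrite adj_delta delta_mx_form. Qed.

Lemma psd_diag n (A : 'M[C]_n) i : psd A -> 0 <= A i i.
Proof. by move=> /psd_form /(_ (delta_mx i 0)); rewrite diag_form mxE eqxx mulr1n. Qed.

Opaque psd.

Lemma psd_diagP n (A : 'M[C]_n) : psd A ->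
  exists P : 'M[C]_n, exists l : 'I_n -> R,
    [/\ P \is unitarymx, A = P^t* *m diag_mx (\row_i rc (l i)) *m P
      & forall i, 0 <= l i].
Proof.
move=> pA; have [P [l [uP eA]]] := herm_diag (psd_adj pA).
exists P, l; split=> // i; rewrite -rc_ge0.
have := psd_diag i (psd_conj P pA).
rewrite {1}eA !mulmxA mul_adj_unitary // mul1mx -mulmxA mul_adj_unitary //.
by rewrite mulmx1 !mxE eqxx mulr1n.
Qed.

Lemma psd_sqrt n (A : 'M[C]_n) : psd A -> exists B : 'M[C]_n, A = B^t* *m B.
Proof.
move=> /psd_diagP [P [l [uP -> l0]]].
exists (diag_mx (\row_i rc (Num.sqrt (l i))) *m P).
rewrite adjM mulmxA -[X in _ = X *m P]mulmxA; congr (_ *m _ *m _).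
rewrite tr_diag_mx map_diag_mx mulmx_diag; congr diag_mx; apply/rowP => i.
by rewrite mxE [RHS]mxE map_conjE !mxE rc_conj -rcM -expr2 sqr_sqrtr.
Qed.

Lemma psd_tens m n (A : 'M[C]_m) (B : 'M[C]_n) : psd A -> psd B -> psd (A *t B).
Proof.
move=> /psd_sqrt [a ->] /psd_sqrt [b ->].
by rewrite -tensM -adj_tens; exact: psd_gram.
Qed.

Lemma tr_psd_ge0 n (A : 'M[C]_n) : psd A -> 0 <= \tr A.
Proof. by move=> pA; apply: sumr_ge0 => i _; exact: psd_diag. Qed.

Lemma tr_psdM_ge0 n (A B : 'M[C]_n) : psd A -> psd B -> 0 <= \tr (A *m B).
Proof.
move=> pA /psd_sqrt [b ->]; rewrite mulmxA trC mulmxA.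
by apply: tr_psd_ge0; exact: psd_conj.
Qed.

End Psd.

Arguments psd_gram {R p n} B.
Arguments psd_conj {R p n} K {A} _.
Arguments psdD {R n A B} _ _.
Arguments psdZ {R n c A} _ _.
Arguments psd0 R n : clear implicits.
Arguments psd1 R n : clear implicits.
Arguments psd_tens {R m n A B} _ _.

                   

(** * Bilinearity of the tensor product *)

Section Tensor.
Variable C : numClosedFieldType.

Lemma tensmxDl m n p q (A B : 'M[C]_(m, n)) (D : 'M[C]_(p, q)) :
  (A + B) *t D = A *t D + B *t D.
Proof. by apply/matrixP => i j; rewrite !mxE mulrDl. Qed.

Lemma tensmxDr m n p q (A B : 'M[C]_(m, n)) (D : 'M[C]_(p, q)) :
  D *t (A + B) = D *t A + D *t B.
Proof. by apply/matrixP => i j; rewrite !mxE mulrDr. Qed.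

Lemma tensmxNl m n p q (A : 'M[C]_(m, n)) (D : 'M[C]_(p, q)) :
  (- A) *t D = - (A *t D).
Proof. by apply/matrixP => i j; rewrite !mxE mulNr. Qed.

Lemma tensmxNr m n p q (A : 'M[C]_(m, n)) (D : 'M[C]_(p, q)) :
  D *t (- A) = - (D *t A).
Proof. by apply/matrixP => i j; rewrite !mxE mulrN. Qed.

Lemma tensmxZl m n p q c (A : 'M[C]_(m, n)) (D : 'M[C]_(p, q)) :
  (c *: A) *t D = c *: (A *t D).
Proof. by apply/matrixP => i j; rewrite !mxE mulrA. Qed.

Lemma tensmxZr m n p q c (A : 'M[C]_(m, n)) (D : 'M[C]_(p, q)) :
  D *t (c *: A) = c *: (D *t A).
Proof. by apply/matrixP => i j; rewrite !mxE mulrCA. Qed.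

Lemma tensmx11 m n : (1%:M : 'M[C]_m) *t (1%:M : 'M[C]_n) = 1%:M.
Proof.
apply/matrixP => i j; case: (mxtens_indexP i) => a b; case: (mxtens_indexP j) => c d.
rewrite tensmxE !mxE -natrM mulnb; congr (_%:R); congr nat_of_bool.
by rewrite (can_eq (@mxtens_indexK _ _)) xpair_eqE.
Qed.

End Tensor.

(** * Unitary conjugation and Cauchy-Schwarz *)

Section Unitary.
Lemma mulmx_unitaryK (F : numClosedFieldType) m n (A : 'M[F]_(m, n)) (P : 'M[F]_n) :
  P \is unitarymx -> A *m P *m P^t* = A.
Proof. by move=> uP; rewrite -mulmxA mul_adj_unitary // mulmx1. Qed.

Lemma mulmx_unitaryKV (F : numClosedFieldType) m n (A : 'M[F]_(m, n)) (P : 'M[F]_n) :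
  P \is unitarymx -> A *m P^t* *m P = A.
Proof. by move=> uP; rewrite -mulmxA adj_mul_unitary // mulmx1. Qed.

Lemma unitary_conj_sub1 (F : numClosedFieldType) n (V B : 'M[F]_n) :
  V \is unitarymx -> 1%:M - V^t* *m B *m V *m (V^t* *m B *m V)^t* =
    V^t* *m (1%:M - B *m B^t*) *m (V^t*)^t*.
Proof.
move=> uV; rewrite !adjM !trmxCK mulmxBr mulmxBl mulmx1 adj_mul_unitary //.
by rewrite !mulmxA (mulmx_unitaryK _ uV).
Qed.

Lemma cauchy_schwarz_sum (F : numClosedFieldType) n (f g : 'I_n -> F) :
  `|\sum_i f i * g i| ^+ 2 <= (\sum_i `|f i| ^+ 2) * (\sum_i `|g i| ^+ 2).
Proof.
have E (a b : 'rV[F]_n) : (a *m b^t*) 0 0 = \sum_i a 0 i * (b 0 i)^*.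
  by rewrite mxE; apply: eq_bigr => i _; rewrite adjE.
have : `|dotmx (\row_i f i) (\row_i (g i)^*)| ^+ 2 <=
    dotmx (\row_i f i) (\row_i f i) * dotmx (\row_i (g i)^*) (\row_i (g i)^*).
  exact: (CauchySchwarz (@dotmx F n) (\row_i f i) (\row_i (g i)^*)).
rewrite !dotmxE !E.
have -> : \sum_i (\row_i f i) 0 i * ((\row_i (g i)^*) 0 i)^* = \sum_i f i * g i.
  by apply: eq_bigr => i _; rewrite !mxE conjCK.
have -> : \sum_i (\row_i f i) 0 i * ((\row_i f i) 0 i)^* = \sum_i `|f i| ^+ 2.
  by apply: eq_bigr => i _; rewrite !mxE normCK.
have -> // : \sum_i (\row_i (g i)^*) 0 i * ((\row_i (g i)^*) 0 i)^* = \sum_i `|g i| ^+ 2.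
by apply: eq_bigr => i _; rewrite !mxE conjCK mulrC normCK.
Qed.

End Unitary.

(** * Duality between the trace norm and contractions *)

Section TraceNorm.
Variable R : realType.
Local Notation C := (Cx R).

(** The unit ball of the operator norm. The trace norm of A is the maximum of |tr(B A)| over it, so
    the error estimates below are made on traces against a fixed test [B]. *)
Definition contraction n (B : 'M[C]_n) : Prop := psd (1%:M - B *m B^t*).

Lemma contraction_unitary n (V B : 'M[C]_n) : V \is unitarymx ->
  contraction B -> contraction (V^t* *m B *m V).
Proof.
by move=> uV cB; rewrite /contraction (unitary_conj_sub1 _ uV); exact: (psd_conj (V^t*) cB).
Qed.

Lemma contraction_tens1r m n (B : 'M[C]_m) :
  contraction B -> contraction (B *t (1%:M : 'M[C]_n)).
Proof.
move=> cB; rewrite /contraction adj_tens tensM adj1 mulmx1 -tensmx11.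
by rewrite -tensmxNl -tensmxDl; exact: (psd_tens cB (psd1 R n)).
Qed.

Lemma contraction_tens1l m n (B : 'M[C]_m) :
  contraction B -> contraction ((1%:M : 'M[C]_n) *t B).
Proof.
move=> cB; rewrite /contraction adj_tens tensM adj1 mulmx1 -tensmx11.
by rewrite -tensmxNr -tensmxDr; exact: (psd_tens (psd1 R n) cB).
Qed.

Lemma contraction_delta n (i j : 'I_n) : contraction (delta_mx i j : 'M[C]_n).
Proof.
rewrite /contraction adj_delta mul_delta_mx.
set P := 1%:M - _; have -> : P = P^t* *m P; last exact: psd_gram.
have -> : P^t* = P by rewrite /P adjB adj1 adj_delta.
by rewrite {3}/P mulmxBr mulmx1 /P mulmxBl mul1mx mul_delta_mx subrr subr0.
Qed.

Lemma contraction_row n (B : 'M[C]_n) i : contraction B ->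
  \sum_j `|B i j| ^+ 2 <= 1.
Proof.
move=> /(@psd_diag _ _ _ i); rewrite !mxE eqxx mulr1n subr_ge0.
by under [X in X <= _]eq_bigr do rewrite adjE -normCK.
Qed.

Lemma contraction_tr_density n (B T : 'M[C]_n) : contraction B -> density T ->
  `|\tr (B *m T)| <= 1.
Proof.
move=> cB [/psd_diagP [P [l [uP eT l0]]] trT].
have {}trT : \sum_i rc (l i) = 1.
  rewrite -trT eT trC mulmxA mul_adj_unitary // mul1mx mxtrace_diag.
  by apply: eq_bigr => i _; rewrite mxE.
have uP' : P^t* \is unitarymx by rewrite trmxC_unitary.
have cB' := contraction_unitary uP' cB; rewrite trmxCK in cB'.
rewrite eT !mulmxA trC !mulmxA -trT.
apply: le_trans (ler_norm_sum _ _ _) _; apply: ler_sum => i _.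
rewrite mul_mx_diag !mxE normrM rc_norm (ger0_norm (l0 i)) ler_piMl ?rc_ge0 //.
have := contraction_row i cB'; rewrite (bigD1 i) //= => h.
rewrite -(@expr_le1 _ 2) //; apply: le_trans h; rewrite mxE lerDl sumr_ge0 // => j _.
Qed.

Lemma trace_norm_polar n (A : 'M[C]_n) :
  exists P : 'M[C]_n, exists r : 'I_n -> R,
    [/\ P \is unitarymx, A^t* *m A = P^t* *m diag_mx (\row_i rc (r i)) *m P,
      forall i, 0 <= r i & trace_norm A = \sum_i Num.sqrt (r i)].
Proof.
have pA := psd_gram A.
have nA : A^t* *m A \is normalmx.
  by apply: hermitian_normalmx; rewrite herm_adj psd_adj.
have uP := spectral_unitarymx (A^t* *m A).
have /orthomx_spectralP eA := nA.
rewrite invmx_unitary // in eA.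
have s0 i : 0 <= spectral_diag (A^t* *m A) 0 i.
  have := psd_diag i (psd_conj (spectralmx (A^t* *m A)) pA).
  rewrite {2}eA !mulmxA mul_adj_unitary // mul1mx -mulmxA mul_adj_unitary //.
  by rewrite mulmx1 !mxE eqxx mulr1n.
exists (spectralmx (A^t* *m A)), (fun i => complex.Re (spectral_diag (A^t* *m A) 0 i)).
split=> //.
- rewrite [LHS]eA; congr (_ *m diag_mx _ *m _); apply/rowP => i.
  by rewrite mxE -rc_Re.
- by move=> i; rewrite -rc_ge0 -rc_Re.
Qed.

Lemma trace_norm_ge0 n (A : 'M[C]_n) : 0 <= trace_norm A.
Proof. by apply: sumr_ge0 => i _; exact: sqrtr_ge0. Qed.

(** In the eigenbasis of [A^t* *m A] the columns of [A] have norms sqrt (r i) and the rows of [B]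
    have norm at most 1; Cauchy-Schwarz then bounds each diagonal entry of the product. *)
Lemma contraction_tr_le n (A B : 'M[C]_n) : contraction B ->
  `|\tr (B *m A)| <= rc (trace_norm A).
Proof.
move=> cB; have [P [r [uP eA r0 ->]]] := trace_norm_polar A.
have uP' : P^t* \is unitarymx by rewrite trmxC_unitary.
have cB' := contraction_unitary uP' cB; rewrite trmxCK in cB'.
have [Y eY] : {Y | Y = P *m A *m P^t*} by exists (P *m A *m P^t*).
have YY : Y^t* *m Y = diag_mx (\row_i rc (r i)).
  rewrite eY !adjM trmxCK !mulmxA (mulmx_unitaryKV _ uP) -[P *m A^t* *m A]mulmxA.
  by rewrite eA !mulmxA mul_adj_unitary // mul1mx mulmx_unitaryK.
have -> : \tr (B *m A) = \tr ((P *m B *m P^t*) *m Y).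
  rewrite eY !mulmxA (mulmx_unitaryKV _ uP).
  by rewrite [RHS]trC !mulmxA adj_mul_unitary // mul1mx.
rewrite rc_sum; apply: le_trans (ler_norm_sum _ _ _) _; apply: ler_sum => i _.
rewrite mxE -(@ler_pXn2r _ 2) ?nnegrE ?normr_ge0 ?rc_ge0 ?sqrtr_ge0 //.
rewrite -(rcX (Num.sqrt (r i))) (sqr_sqrtr (r0 i)); apply: le_trans (cauchy_schwarz_sum _ _) _.
have -> : \sum_j `|Y j i| ^+ 2 = rc (r i).
  have /matrixP /(_ i i) := YY; rewrite !mxE eqxx mulr1n => <-.
  by apply: eq_bigr => j _; rewrite adjE normCK mulrC.
by rewrite ler_piMl ?rc_ge0 // contraction_row.
Qed.

(** The extremal [B] is the adjoint of the partial isometry in the polar decomposition of [A]. *)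
Lemma trace_norm_attained n (A : 'M[C]_n) :
  exists2 B : 'M[C]_n, contraction B & \tr (B *m A) = rc (trace_norm A).
Proof.
have [P [r [uP eA r0 ->]]] := trace_norm_polar A.
(* As 0^-1 = 0, [D] is the pseudo-inverse of |A| written in its eigenbasis. *)
have [D eD] : {D : 'M[C]_n | D = diag_mx (\row_i rc (Num.sqrt (r i))^-1)} by eexists.
have aD : D^t* = D.
  rewrite eD tr_diag_mx map_diag_mx; congr diag_mx; apply/rowP => i.
  by rewrite map_conjE !mxE rc_conj.
have [Y eY] : {Y | Y = A *m P^t*} by exists (A *m P^t*).
have YY : Y^t* *m Y = diag_mx (\row_i rc (r i)).
  rewrite eY adjM trmxCK !mulmxA -[P *m A^t* *m A]mulmxA eA !mulmxA.
  by rewrite mul_adj_unitary // mul1mx mulmx_unitaryK.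
(* This is the projection onto the eigenvectors with [r i != 0]. Hence the matrix to be shown psd is
   conjugate to the complementary projection, a sum of rank-one psd matrices. *)
have DE : D *m (Y^t* *m Y) *m D^t* = diag_mx (\row_i rc (r i != 0)%:R).
  rewrite YY aD eD !mulmx_diag; congr diag_mx; apply/rowP => i; rewrite !mxE -!rcM.
  congr rc; have [->|ri] := eqVneq (r i) 0; first by rewrite mulr0 mul0r.
  by rewrite mulrAC -expr2 exprVn (sqr_sqrtr (r0 i)) mulVf.
exists (P^t* *m (D *m Y^t*)).
  rewrite /contraction.
  have -> : 1%:M - P^t* *m (D *m Y^t*) *m (P^t* *m (D *m Y^t*))^t* =
     P^t* *m (1%:M - D *m (Y^t* *m Y) *m D^t*) *m (P^t*)^t*.
    rewrite mulmxBr mulmxBl mulmx1 trmxCK adj_mul_unitary // !adjM !trmxCK.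
    by rewrite !mulmxA.
  apply: psd_conj; rewrite DE.
  have -> : 1%:M - diag_mx (\row_i rc (r i != 0)%:R) =
      \sum_(i | r i == 0) (delta_mx i (0 : 'I_1))
        *m (delta_mx i (0 : 'I_1))^t* :> 'M[C]_n.
    apply/matrixP => i j; rewrite summxE !mxE -rc1.
    under eq_bigr do rewrite adj_delta mul_delta_mx mxE.
    have [<-|ij] := eqVneq i j; last first.
      rewrite !mulr0n subr0 big1 // => k _; case: eqP => //= <-.
      by rewrite eq_sym (negPf ij).
    have [ri|ri] := eqVneq (r i) 0.
      rewrite (bigD1 i) ?ri ?eqxx //= big1 ?mulr0n ?rc0 ?subr0 ?addr0 // => k /andP[_ ki].
      by rewrite eq_sym (negPf ki).
    rewrite mulr1n subrr big1 // => k rk; case: eqP => // ik.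
    by rewrite -ik (negPf ri) in rk.
  by apply: psd_sum => i _; rewrite -{1}[delta_mx i 0]trmxCK; exact: psd_gram.
have -> : P^t* *m (D *m Y^t*) *m A = P^t* *m (D *m (Y^t* *m Y)) *m P.
  by rewrite eY !mulmxA (mulmx_unitaryKV _ uP).
rewrite trC mulmxA mul_adj_unitary // mul1mx YY eD mulmx_diag mxtrace_diag.
rewrite rc_sum; apply: eq_bigr => i _; rewrite !mxE -rcM; congr rc.
have [->|ri] := eqVneq (r i) 0; first by rewrite sqrtr0 mulr0.
rewrite -{2}(sqr_sqrtr (r0 i)) expr2 mulrA mulVf ?mul1r //.
by rewrite gt_eqF // sqrtr_gt0 lt_def ri r0.
Qed.

Lemma trace_norm_le n (A : 'M[C]_n) (e : R) :
  (forall B : 'M[C]_n, contraction B -> `|\tr (B *m A)| <= rc e) ->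
  trace_norm A <= e.
Proof.
move=> h; have [B cB e1] := trace_norm_attained A.
by have := h B cB; rewrite e1 rc_norm rc_le ger0_norm // trace_norm_ge0.
Qed.

End TraceNorm.

                            

(** * Functional calculus: matrices diagonal in a common unitary eigenbasis *)

HB.lock Definition udiag (C : numClosedFieldType) (n : nat)
    (P : 'M[C]_n) (a : 'I_n -> C) : 'M[C]_n :=
  P^t* *m diag_mx (\row_i a i) *m P.

Section UnitaryDiagonal.
Variable C : numClosedFieldType.

Lemma udiag_def n (P : 'M[C]_n) a : udiag P a = P^t* *m diag_mx (\row_i a i) *m P.
Proof. by rewrite udiag.unlock. Qed.

Lemma udiagE n (P : 'M[C]_n) a i j :
  udiag P a i j = \sum_k (P k i)^* * a k * P k j.
Proof.
rewrite !udiag_def mxE; apply: eq_bigr => k _; congr (_ * _).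
by rewrite mul_mx_diag mxE adjE mxE.
Qed.

Lemma udiagM n (P : 'M[C]_n) a b : P \is unitarymx ->
  udiag P a *m udiag P b = udiag P (fun i => a i * b i).
Proof.
move=> uP; rewrite !udiag_def !mulmxA (mulmx_unitaryK _ uP) -[X in X *m P = _]mulmxA.
by rewrite mulmx_diag; congr (_ *m diag_mx _ *m _); apply/rowP => i; rewrite !mxE.
Qed.

Lemma udiag1 n (P : 'M[C]_n) : P \is unitarymx -> udiag P (fun=> 1) = 1%:M.
Proof.
move=> uP; rewrite !udiag_def (_ : \row_i _ = const_mx 1).
  by rewrite diag_const_mx mulmx1 adj_mul_unitary.
by apply/rowP => i; rewrite !mxE.
Qed.

Lemma udiag_adj n (P : 'M[C]_n) a : (udiag P a)^t* = udiag P (fun i => (a i)^*).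
Proof.
apply/matrixP => i j; rewrite adjE !udiagE rmorph_sum; apply: eq_bigr => k _ /=.
by rewrite !rmorphM /= conjCK [RHS]mulrAC; ring.
Qed.

Lemma udiagZ n (P : 'M[C]_n) c a : c *: udiag P a = udiag P (fun i => c * a i).
Proof.
apply/matrixP => i j; rewrite mxE !udiagE mulr_sumr; apply: eq_bigr => k _.
by rewrite mulrA [c * _]mulrCA mulrA.
Qed.

Lemma udiagX n (P : 'M[C]_n) a k : P \is unitarymx ->
  (udiag P a) ^+ k = udiag P (fun i => a i ^+ k).
Proof.
move=> uP; elim: k => [|k IH]; first by rewrite expr0 (udiag1 uP).
by rewrite exprS IH -[_ * _]/(_ *m _) udiagM //; congr udiag; apply/funext => i; rewrite exprS.
Qed.

Lemma tens_udiag m n (P : 'M[C]_m) (Q : 'M[C]_n) a b :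
  udiag P a *t udiag Q b =
  udiag (P *t Q) (fun k => a (mxtens_unindex k).1 * b (mxtens_unindex k).2).
Proof.
rewrite !udiag_def -!tensM -adj_tens; congr (_ *m _ *m _).
apply/matrixP => i j; case: (mxtens_indexP i) => i1 i2; case: (mxtens_indexP j) => j1 j2.
rewrite tensmxE !mxE mxtens_indexK /= (can_eq (@mxtens_indexK _ _)) xpair_eqE.
by case: eqP; case: eqP; rewrite ?mulr1n ?mulr0n ?mulr0 ?mul0r.
Qed.

Lemma unitary_tens m n (P : 'M[C]_m) (Q : 'M[C]_n) :
  P \is unitarymx -> Q \is unitarymx -> P *t Q \is unitarymx.
Proof.
move=> uP uQ; apply/unitarymxP.
by rewrite adj_tens tensM !mul_adj_unitary // tensmx11.
Qed.

Lemma udiagD n (P : 'M[C]_n) a b : udiag P a + udiag P b = udiag P (fun i => a i + b i).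
Proof.
apply/matrixP => i j; rewrite mxE !udiagE -big_split; apply: eq_bigr => k _.
by rewrite /= -mulrDl -mulrDr.
Qed.

Lemma udiag_sum (I : Type) (r : seq I) n (P : 'M[C]_n) (a : I -> 'I_n -> C) :
  \sum_(i <- r) udiag P (a i) = udiag P (fun k => \sum_(i <- r) a i k).
Proof.
apply/matrixP => i j; rewrite summxE udiagE.
under eq_bigr do rewrite udiagE.
rewrite exchange_big; apply: eq_bigr => k _.
by rewrite mulr_sumr mulr_suml.
Qed.

Lemma eq_udiag n (P : 'M[C]_n) a b : a =1 b -> udiag P a = udiag P b.
Proof. by move=> ab; congr udiag; apply/funext. Qed.

Lemma tr_udiag n (P : 'M[C]_n) a : P \is unitarymx -> \tr (udiag P a) = \sum_i a i.
Proof.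
move=> uP; rewrite !udiag_def trC mulmxA mul_adj_unitary // mul1mx mxtrace_diag.
by apply: eq_bigr => i _; rewrite mxE.
Qed.

Lemma tr_tens m n (A : 'M[C]_m) (B : 'M[C]_n) : \tr (A *t B) = \tr A * \tr B.
Proof.
rewrite /mxtrace mulr_sum; apply: eq_bigr => i _.
by rewrite mxE.
Qed.

Lemma tens_udiag_sum m n (P : 'M[C]_m) (Q : 'M[C]_n) a b :
  P \is unitarymx -> Q \is unitarymx ->
  udiag P a *t 1%:M + 1%:M *t udiag Q b =
  udiag (P *t Q) (fun k => a (mxtens_unindex k).1 + b (mxtens_unindex k).2).
Proof.
move=> uP uQ.
rewrite -[X in _ *t X + _](udiag1 uQ) -[X in _ + X *t _](udiag1 uP).
rewrite !tens_udiag udiagD; apply: eq_udiag => k.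
by rewrite mulr1 mul1r.
Qed.

End UnitaryDiagonal.

(** * Entrywise convergence of matrices *)

Section Convergence.
Variable C : numClosedFieldType.

Lemma cvg_mx_entries m n (X : nat -> 'M[C]_(m, n)) (L : 'M[C]_(m, n)) :
  (forall i j, (fun k => X k i j) @ \oo --> L i j) -> X @ \oo --> L.
Proof.
move=> h A [P PL sPA]; apply: (@filterS _ \oo _
  (fun k => forall ij : 'I_m * 'I_n, P ij.1 ij.2 (X k ij.1 ij.2))).
  by move=> k Pk; apply: sPA => i j; exact: (Pk (i, j)).
apply: (@filter_forall nat _ (fun ij => [set k | P ij.1 ij.2 (X k ij.1 ij.2)]) \oo).
by move=> [i j] /=; exact: h (PL i j).
Qed.

Lemma mx_entries_cvg m n (X : nat -> 'M[C]_(m, n)) (L : 'M[C]_(m, n)) i j :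
  X @ \oo --> L -> (fun k => X k i j) @ \oo --> L i j.
Proof.
move=> XL A nA; apply: (XL [set N : 'M[C]_(m, n) | A (N i j)]).
exists (fun i' j' => [set x | i' = i -> j' = j -> A x]) => [i' j'|N /(_ i j)] /=; last exact.
have [->|ii] := eqVneq i' i; last first.
  by apply: filterS filterT => x _ /eqP; rewrite (negPf ii).
have [->|jj] := eqVneq j' j; last first.
  by apply: filterS filterT => x _ _ /eqP; rewrite (negPf jj).
by apply: filterS nA => x Ax _ _.
Qed.

Lemma cvg_sumr (I : Type) (r : seq I) (u : I -> nat -> C) (l : I -> C) :
  (forall i, u i @ \oo --> l i) ->
  (fun k => \sum_(i <- r) u i k) @ \oo --> \sum_(i <- r) l i.
Proof.
move=> h; elim: r => [|i r IH].
  rewrite big_nil (_ : (fun k => _) = fun=> 0); first exact: cvg_cst.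
  by apply/funext => k; rewrite big_nil.
rewrite big_cons (_ : (fun k => _) = fun k => u i k + \sum_(i <- r) u i k).
  by apply: cvgD.
by apply/funext => k; rewrite big_cons.
Qed.

Lemma cvg_linear_form m n (X : nat -> 'M[C]_(m, n)) (L : 'M[C]_(m, n))
    (f : {linear 'M[C]_(m, n) -> C^o}) :
  X @ \oo --> L -> (fun k => f (X k) : C) @ \oo --> (f L : C).
Proof.
move=> XL.
have fE Y : f Y = \sum_i \sum_j Y i j * f (delta_mx i j) :> C.
  rewrite {1}(matrix_sum_delta Y) linear_sum; apply: eq_bigr => i _.
  by rewrite linear_sum; apply: eq_bigr => j _; rewrite linearZ.
rewrite fE (_ : (fun k => _) = (fun k => \sum_i \sum_j X k i j * (f (delta_mx i j) : C)));
  last by apply/funext => k; rewrite fE.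
apply: cvg_sumr => i; apply: cvg_sumr => j.
by apply: cvgM; [exact: mx_entries_cvg | exact: cvg_cst].
Qed.

End Convergence.

Section ComplexConvergence.
Variable R : realType.
Local Notation C := (Cx R).

Lemma cvg_CxP (u : nat -> C) (l : C) :
  u @ \oo --> l <->
  forall e : R, 0 < e -> exists N, forall n, (N <= n)%N -> `|u n - l| <= rc e.
Proof.
split=> [/cvgrPdist_le h e e0|h].
  have e0' : 0 < rc e by rewrite -rc0 rc_lt.
  have [N _ hN] := h _ e0'; exists N => n Nn; rewrite distrC; exact: hN.
apply/cvgrPdist_le => e e0.
have ee : e = rc (complex.Re e) by apply: rc_Re; exact: ltW.
rewrite ee -rc0 rc_lt in e0; have [N hN] := h _ e0.
by exists N => // n Nn; rewrite distrC ee; exact: hN.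
Qed.

Lemma rc_cvg (u : nat -> R) (l : R) :
  u @ \oo --> l -> (fun k => rc (u k)) @ \oo --> rc l.
Proof.
move=> /cvgrPdist_le h; apply/cvg_CxP => e e0; have [N _ hN] := h _ e0.
by exists N => n Nn; rewrite distrC -rcB rc_norm rc_le; exact: hN.
Qed.

End ComplexConvergence.


(** * Matrix exponentials, propagators and Gibbs states *)

Section Exponential.
Variable R : realType.
Local Notation C := (Cx R).

(** [e] is x |-> exp (z x), given by its series and its addition law. Lemmas stated for such a pair
    treat propagators (z = -it) and Boltzmann factors (z = -beta) alike. *)
Definition is_exp (z : C) (e : R -> C) : Prop :=
  (forall x, series (fun k => (k`!%:R : C)^-1 * (z * rc x) ^+ k) @ \oo --> e x) /\
  (forall x y, e (x + y) = e x * e y).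

Lemma is_exp_real (b : R) : is_exp (rc b) (fun x => rc (expR (b * x))).
Proof.
split=> [x|x y]; last by rewrite mulrDr expRD rcM.
rewrite (_ : series _ = fun n => rc (series (exp_coeff (b * x)) n)).
  by apply: rc_cvg; exact: is_cvg_series_exp_coeff.
apply/funext => n; rewrite /series /= rc_sum; apply: eq_bigr => k _.
by rewrite /exp_coeff /= rcM rcV rc_nat rcX rcM mulrC.
Qed.

Definition cis (x : R) : C := rc (cos x) + 'i * rc (sin x).

Lemma cisD x y : cis (x + y) = cis x * cis y.
Proof.
rewrite /cis cosD sinD rcB !rcD !rcM.
have := sqrCi C; move: (rc (cos x)) (rc (sin x)) (rc (cos y)) (rc (sin y)).
move=> a b c d i2.
have -> : (a + 'i * b) * (c + 'i * d) = a * c + 'i ^+ 2 * (b * d) + 'i * (b * c + a * d) by ring.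
by rewrite i2 mulN1r.
Qed.

Lemma cis0 : cis 0 = 1.
Proof. by rewrite /cis cos0 sin0 rc0 rc1 mulr0 addr0. Qed.

Lemma cispi : cis pi = -1.
Proof. by rewrite /cis cospi sinpi rc0 rcN rc1 mulr0 addr0. Qed.

Lemma cis_conj x : (cis x)^* = cis (- x).
Proof.
by rewrite /cis rmorphD rmorphM /= !rc_conj conjCi cosN sinN rcN mulrN mulNr.
Qed.

Lemma is_exp_imag (t : R) : is_exp ('i * rc t) (fun x => cis (t * x)).
Proof.
split=> [x|x y]; last by rewrite mulrDr cisD.
rewrite (_ : series _ = fun n => rc (series (cos_coeff (t * x)) n) +
   'i * rc (series (sin_coeff (t * x)) n)).
  apply: cvgD; first by apply: rc_cvg; rewrite unlock; exact: is_cvg_series_cos_coeff.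
  apply: cvgM; first exact: cvg_cst.
  by apply: rc_cvg; rewrite unlock; exact: is_cvg_series_sin_coeff.
apply/funext => n; rewrite /series /= !rc_sum mulr_sumr -big_split /=.
apply: eq_bigr => k _; rewrite /cos_coeff /sin_coeff /= -mulrA -rcM exprMn.
rewrite !rcM !rcX rcV !rc_nat rcN rc1 -!rcM.
(* Even powers of ['i] feed the cosine series and odd ones the sine series; the coefficients of
   these series carry the same parity factors. *)
have -> : 'i ^+ k = (~~ odd k)%:R * (-1) ^+ k./2 + 'i * ((odd k)%:R * (-1) ^+ k.-1./2) :> C.
  rewrite -{1}(odd_double_half k) exprD -mul2n exprM sqrCi.
  case ok: (odd k) => /=; last by rewrite expr0 !mul1r mul0r mulr0 addr0.
  rewrite expr1 mul0r add0r mul1r; congr (_ * _ ^+ _).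
  by rewrite -{2}(odd_double_half k) ok add1n /= doubleK.
move: (_ ^+ k) => X; rewrite mulrDl mulrDr.
by congr (_ + _); rewrite -!mulrA mulrC -!mulrA [in LHS]mulrA; ring.
Qed.

Lemma is_expN z e : is_exp z e -> is_exp (- z) (fun x => e (- x)).
Proof.
move=> [h1 h2]; split=> [x|x y]; last by rewrite opprD h2.
by have := h1 (- x); rewrite rcN mulrN -mulNr.
Qed.

Lemma expmx_udiag n (P : 'M[C]_n) (l : 'I_n -> R) z e :
  P \is unitarymx -> is_exp z e ->
  expmx (z *: udiag P (fun i => rc (l i))) = udiag P (fun i => e (l i)).
Proof.
move=> uP [h _]; apply: cvg_lim; first exact: norm_hausdorff.
apply: cvg_mx_entries => i j; rewrite udiagE.
rewrite (_ : (fun k => _) = fun m => \sum_k (P k i)^* *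
  (series (fun p => (p`!%:R : C)^-1 * (z * rc (l k)) ^+ p) m) * P k j).
  apply: cvg_sumr => k; apply: cvgM; last exact: cvg_cst.
  by apply: cvgM; [exact: cvg_cst|exact: h].
apply/funext => m; rewrite /series /= summxE.
transitivity (\sum_(0 <= p < m) \sum_k (P k i)^* *
   ((p`!%:R)^-1 * (z * rc (l k)) ^+ p) * P k j).
  by apply: eq_bigr => p _; rewrite udiagZ udiagX // udiagZ udiagE.
by rewrite exchange_big; apply: eq_bigr => k _; rewrite mulr_sumr mulr_suml.
Qed.

(** In the eigenbasis, commutation says that entry (i, j) of [U] vanishes unless l i = l j, and then
    e (l i) = e (l j) as well. *)
Lemma udiag_comm n (P U : 'M[C]_n) (l : 'I_n -> R) (e : R -> C) :
  P \is unitarymx ->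
  U *m udiag P (fun i => rc (l i)) = udiag P (fun i => rc (l i)) *m U ->
  U *m udiag P (fun i => e (l i)) = udiag P (fun i => e (l i)) *m U.
Proof.
move=> uP h.
have [V eV] : {V | V = P *m U *m P^t*} by exists (P *m U *m P^t*).
have eU : U = P^t* *m V *m P.
  by rewrite eV !mulmxA adj_mul_unitary // mul1mx mulmx_unitaryKV.
have F (f : 'I_n -> C) : (U *m udiag P f = udiag P f *m U) <->
    (V *m diag_mx (\row_i f i) = diag_mx (\row_i f i) *m V).
  rewrite eU !udiag_def !mulmxA !(mulmx_unitaryK _ uP); split=> [h1|h1].
    have := congr1 (fun X => P *m X *m P^t*) h1.
    by rewrite !mulmxA !(mulmx_unitaryK _ uP) mul_adj_unitary // !mul1mx.
  by congr (_ *m P); rewrite -!mulmxA h1.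
apply/F; move/F: h => /matrixP h; apply/matrixP => i j; have := h i j.
rewrite !mul_mx_diag !mul_diag_mx !mxE => h1.
have [->|ij] := eqVneq (l i) (l j); first by rewrite mulrC.
have : V i j * (rc (l j) - rc (l i)) = 0 by rewrite mulrBr h1 mulrC subrr.
move/eqP; rewrite mulf_eq0 subr_eq0 (inj_eq (@rc_inj R)) [l j == _]eq_sym (negPf ij) orbF.
by move/eqP->; rewrite mul0r mulr0.
Qed.

Lemma herm_udiag n (K : 'M[C]_n) : K^t* = K ->
  exists P l, P \is unitarymx /\ K = udiag P (fun i => rc (l i)).
Proof. by move=> /herm_diag [P [l [uP eK]]]; exists P, l; rewrite udiag_def. Qed.

Lemma expmx_tens m n (A : 'M[C]_m) (B : 'M[C]_n) z e :
  A^t* = A -> B^t* = B -> is_exp z e ->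
  expmx (z *: (A *t 1%:M + 1%:M *t B)) = expmx (z *: A) *t expmx (z *: B).
Proof.
move=> /herm_udiag [P [a [uP ->]]] /herm_udiag [Q [b [uQ ->]]] ze.
rewrite (expmx_udiag _ uP ze) (expmx_udiag _ uQ ze).
have -> : udiag P (fun i => rc (a i)) *t 1%:M + 1%:M *t udiag Q (fun i => rc (b i)) =
    udiag (P *t Q) (fun k => rc (a (mxtens_unindex k).1 + b (mxtens_unindex k).2)).
  by rewrite (tens_udiag_sum _ _ uP uQ); apply: eq_udiag => k; rewrite rcD.
rewrite tens_udiag.
by rewrite (expmx_udiag _ (unitary_tens uP uQ) ze); apply: eq_udiag => k; exact: ze.2.
Qed.

Lemma expmx_comm n (K U : 'M[C]_n) z e :
  K^t* = K -> is_exp z e -> U *m K = K *m U ->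
  U *m expmx (z *: K) = expmx (z *: K) *m U.
Proof.
move=> /herm_udiag [P [a [uP ->]]] ze h.
by rewrite (expmx_udiag _ uP ze); exact: udiag_comm h.
Qed.

Definition propagator n (K : 'M[C]_n) (t : R) : 'M[C]_n := expmx (- ('i * rc t) *: K).

Lemma is_exp_prop t : is_exp (- ('i * rc t)) (fun x => cis (- (t * x))).
Proof.
have := is_expN (is_exp_imag t).
by rewrite (_ : (fun x => cis (t * - x)) = fun x => cis (- (t * x))) //;
  apply/funext => x; rewrite mulrN.
Qed.

Lemma prop_udiag n (P : 'M[C]_n) l t : P \is unitarymx ->
  propagator (udiag P (fun i => rc (l i))) t = udiag P (fun i => cis (- (t * l i))).
Proof. by move=> uP; exact: (expmx_udiag _ uP (is_exp_prop t)). Qed.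

Lemma evolE n (K : 'M[C]_n) t L : K^t* = K ->
  evol K t L = propagator K t *m L *m (propagator K t)^t*.
Proof.
move=> /herm_udiag [P [a [uP ->]]]; rewrite /evol -/(propagator _ t); congr (_ *m _).
rewrite prop_udiag // udiag_adj (expmx_udiag _ uP (is_exp_imag t)).
by apply: eq_udiag => i; rewrite cis_conj opprK.
Qed.

Lemma prop_unitary n (K : 'M[C]_n) t : K^t* = K -> propagator K t \is unitarymx.
Proof.
move=> /herm_udiag [P [a [uP ->]]]; apply/unitarymxP.
rewrite prop_udiag // udiag_adj udiagM // -(udiag1 uP); apply: eq_udiag => i.
by rewrite cis_conj -cisD subrr cis0.
Qed.

Lemma prop_comm n (K U : 'M[C]_n) t : K^t* = K -> U *m K = K *m U ->
  U *m propagator K t = propagator K t *m U.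
Proof. by move=> hK; exact: (expmx_comm hK (is_exp_prop t)). Qed.

Lemma prop_tens m n (A : 'M[C]_m) (B : 'M[C]_n) t : A^t* = A -> B^t* = B ->
  propagator (A *t 1%:M + 1%:M *t B) t = propagator A t *t propagator B t.
Proof. by move=> hA hB; exact: (expmx_tens hA hB (is_exp_prop t)). Qed.

Definition boltzmann n (beta : R) (K : 'M[C]_n) : 'M[C]_n := expmx (- rc beta *: K).

Lemma is_exp_boltz beta : is_exp (- rc beta) (fun x => rc (expR (- beta * x))).
Proof. by rewrite -rcN; exact: is_exp_real. Qed.

Lemma boltz_udiag n beta (P : 'M[C]_n) l : P \is unitarymx ->
  boltzmann beta (udiag P (fun i => rc (l i))) = udiag P (fun i => rc (expR (- beta * l i))).
Proof. by move=> uP; exact: (expmx_udiag _ uP (is_exp_boltz beta)). Qed.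

Lemma psd_udiag n (P : 'M[C]_n) (a : 'I_n -> R) :
  (forall i, 0 <= a i) -> psd (udiag P (fun i => rc (a i))).
Proof.
move=> a0.
have -> : udiag P (fun i => rc (a i)) = P^t* *m udiag 1%:M (fun i => rc (a i)) *m (P^t*)^t*.
  by rewrite !udiag_def adj1 mul1mx mulmx1 trmxCK.
apply: psd_conj.
have -> : udiag 1%:M (fun i => rc (a i)) = (udiag (1%:M : 'M[C]_n) (fun i => rc (Num.sqrt (a i))))^t* *m udiag 1%:M (fun i => rc (Num.sqrt (a i))).
  rewrite udiag_adj udiagM; last by apply/unitarymxP; rewrite adj1 mulmx1.
  apply: eq_udiag => i; rewrite rc_conj -rcM; congr rc.
  by rewrite -expr2 (sqr_sqrtr (a0 i)).
exact: psd_gram.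
Qed.

Lemma tr_boltz_gt0 n beta (K : 'M[C]_n) : (0 < n)%N -> K^t* = K ->
  exists2 z : R, 0 < z & \tr (boltzmann beta K) = rc z.
Proof.
move=> n0 /herm_udiag [P [a [uP ->]]]; rewrite boltz_udiag // tr_udiag //.
exists (\sum_i expR (- beta * a i)); last by rewrite rc_sum.
rewrite (bigD1 (Ordinal n0)) //=.
by rewrite ltr_wpDr ?expR_gt0 // sumr_ge0 // => i _; exact: expR_ge0.
Qed.

Lemma density_gibbs n beta (K : 'M[C]_n) : (0 < n)%N -> K^t* = K ->
  density (gibbs beta K).
Proof.
move=> n0 hK; have [z z0 ez] := tr_boltz_gt0 beta n0 hK.
rewrite /gibbs -/(boltzmann beta K) ez; split.
  apply: psdZ; first by rewrite -rcV rc_ge0 invr_ge0 ltW.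
  have [P [a [uP ->]]] := herm_udiag hK; rewrite boltz_udiag //.
  by apply: psd_udiag => i; exact: expR_ge0.
by rewrite mxtraceZ ez mulVf // -rc0 (inj_eq (@rc_inj R)) gt_eqF.
Qed.

Lemma gibbs_tens m n beta (A : 'M[C]_m) (B : 'M[C]_n) : A^t* = A -> B^t* = B ->
  gibbs beta (A *t 1%:M + 1%:M *t B) = gibbs beta A *t gibbs beta B.
Proof.
move=> hA hB; rewrite /gibbs (expmx_tens hA hB (is_exp_boltz beta)).
by rewrite tr_tens invfM tensmxZl tensmxZr scalerA.
Qed.

Lemma gibbs_comm n beta (K U : 'M[C]_n) : K^t* = K -> U *m K = K *m U ->
  U *m gibbs beta K = gibbs beta K *m U.
Proof.
move=> hK UK; rewrite /gibbs -scalemxAr -scalemxAl.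
by rewrite (expmx_comm hK (is_exp_boltz beta) UK).
Qed.

End Exponential.

                 

(** * Sums over tensor indices *)

Section PartialMeasurement.
Variable C : numClosedFieldType.

Lemma sum_mxtens m n (F : 'I_(m * n) -> C) :
  \sum_k F k = \sum_i \sum_j F (mxtens_index (i, j)).
Proof.
rewrite pair_big (reindex (@mxtens_index m n)) /=; last first.
  by exists (@mxtens_unindex m n) => k _; rewrite (mxtens_indexK, mxtens_unindexK).
by apply: eq_bigr => -[i j].
Qed.

Lemma tensmx_suml (I : Type) (r : seq I) (P : pred I) m n p q
    (F : I -> 'M[C]_(m, n)) (B : 'M[C]_(p, q)) :
  (\sum_(i <- r | P i) F i) *t B = \sum_(i <- r | P i) (F i *t B).
Proof.
apply: (big_morph (fun A : 'M[C]_(m, n) => A *t B)) => [x y|]; last exact: tens0mx.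
exact: tensmxDl.
Qed.

Lemma tensmx_sumr (I : Type) (r : seq I) (P : pred I) m n p q
    (F : I -> 'M[C]_(m, n)) (B : 'M[C]_(p, q)) :
  B *t (\sum_(i <- r | P i) F i) = \sum_(i <- r | P i) (B *t F i).
Proof.
apply: (big_morph (fun A : 'M[C]_(m, n) => B *t A)) => [x y|]; last exact: tensmx0.
exact: tensmxDr.
Qed.

Lemma mx_tensP m n (X Y : 'M[C]_(m * n)) :
  (forall i j r s, X (mxtens_index (i, r)) (mxtens_index (j, s)) =
                   Y (mxtens_index (i, r)) (mxtens_index (j, s))) -> X = Y.
Proof.
move=> h; apply/matrixP => k l.
by case: (mxtens_indexP k) => i r; case: (mxtens_indexP l) => j s.
Qed.

Lemma ex_linear (U V : lmodType C) (f : U -> V) : linear f ->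
  exists F : {linear U -> V}, forall x, F x = f x.
Proof.
move=> lf.
pose F : {linear U -> V} := HB.pack f (GRing.isLinear.Build _ _ _ _ f lf).
by exists F.
Qed.

End PartialMeasurement.

(** * Complete positivity, partial measurement and twirling *)

Section Channels.
Variable R : realType.
Local Notation C := (Cx R).

Lemma block_decomp k m (X : 'M[C]_(k * m)) :
  X = \sum_(i < k) \sum_(j < k) (delta_mx i j *t block X i j).
Proof.
apply: mx_tensP => i j r s; rewrite summxE (bigD1 i) //= summxE (bigD1 j) //=.
rewrite tensmxE !mxE !eqxx mul1r !big1 ?addr0 //.
  move=> l /negPf li; rewrite summxE big1 // => l' _.
  by rewrite tensmxE mxE [i == l]eq_sym li mul0r.
by move=> l /negPf li; rewrite tensmxE mxE eqxx [j == l]eq_sym li mul0r.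
Qed.

Lemma block_tens k m (A : 'M[C]_k) (B : 'M[C]_m) i j :
  block (A *t B) i j = A i j *: B.
Proof. by apply/matrixP => r s; rewrite mxE tensmxE mxE. Qed.

Lemma blockD k m (X Y : 'M[C]_(k * m)) i j : block (X + Y) i j = block X i j + block Y i j.
Proof. by apply/matrixP => r s; rewrite !mxE. Qed.

Lemma blockZ k m c (X : 'M[C]_(k * m)) i j : block (c *: X) i j = c *: block X i j.
Proof. by apply/matrixP => r s; rewrite !mxE. Qed.

Lemma block_ampl k m n (E : 'M[C]_m -> 'M[C]_n) (X : 'M[C]_(k * m)) i j :
  block (ampl E X) i j = E (block X i j).
Proof.
apply/matrixP => r s; rewrite mxE /ampl summxE (bigD1 i) //= summxE (bigD1 j) //=.
rewrite tensmxE mxE !eqxx mul1r !big1 ?addr0 //.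
  move=> l /negPf li; rewrite summxE big1 // => l' _.
  by rewrite tensmxE mxE [i == l]eq_sym li mul0r.
by move=> l /negPf li; rewrite tensmxE mxE eqxx [j == l]eq_sym li mul0r.
Qed.

Lemma blockP k m (X Y : 'M[C]_(k * m)) :
  (forall i j, block X i j = block Y i j) -> X = Y.
Proof.
move=> h; rewrite (block_decomp X) (block_decomp Y).
by under eq_bigr do under eq_bigr do rewrite h.
Qed.

Definition completely_positive m n (E : 'M[C]_m -> 'M[C]_n) : Prop :=
  forall k (X : 'M[C]_(k * m)), psd X -> psd (ampl E X).

Lemma cp_comp m n p (E : 'M[C]_m -> 'M[C]_n) (F : 'M[C]_n -> 'M[C]_p) :
  completely_positive E -> completely_positive F -> completely_positive (F \o E).
Proof.
move=> cE cF k X pX.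
have -> : ampl (F \o E) X = ampl F (ampl E X).
  by apply: blockP => i j; rewrite !block_ampl.
exact: cF (cE _ _ pX).
Qed.

Lemma cp_sum (I : Type) (r : seq I) m n (E : I -> 'M[C]_m -> 'M[C]_n) :
  (forall i, completely_positive (E i)) -> completely_positive (fun X => \sum_(i <- r) E i X).
Proof.
move=> cE k X pX.
have -> : ampl (fun X => \sum_(i <- r) E i X) X = \sum_(i <- r) ampl (E i) X.
  rewrite /ampl [RHS]exchange_big; apply: eq_bigr => i _.
  by rewrite [RHS]exchange_big; apply: eq_bigr => j _; rewrite tensmx_sumr.
by apply: psd_sum => i _; exact: cE.
Qed.

Lemma cp_ext m n (E F : 'M[C]_m -> 'M[C]_n) : E =1 F -> completely_positive E -> completely_positive F.
Proof. by move=> /funext ->. Qed.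

Lemma cp_conj m n (K : 'M[C]_(n, m)) : completely_positive (fun X => K *m X *m K^t*).
Proof.
move=> k X pX.
have -> : ampl (fun X => K *m X *m K^t*) X =
    (1%:M *t K) *m X *m ((1%:M : 'M[C]_k) *t K)^t*; last exact: (psd_conj _ pX).
rewrite {2}(block_decomp X) mulmx_sumr mulmx_suml; apply: eq_bigr => i _.
rewrite mulmx_sumr mulmx_suml; apply: eq_bigr => j _.
by rewrite adj_tens adj1 !tensM mul1mx mulmx1.
Qed.

                                                                          
                                                                   
(** This is Tr_a ((M (x) 1) X), written on blocks. For psd [M] it sends a state to the unnormalised
    state left on the second factor when the effect [M] occurs on the first; for [M = 1] it is the
    partial trace. *)
Definition pt a b (M : 'M[C]_a) (X : 'M[C]_(a * b)) : 'M[C]_b :=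
  \sum_i \sum_j M j i *: block X i j.

Lemma pt_linear a b (M : 'M[C]_a) : linear (@pt a b M).
Proof.
move=> c X Y; rewrite /pt scaler_sumr -big_split; apply: eq_bigr => i _ /=.
rewrite scaler_sumr -big_split; apply: eq_bigr => j _ /=.
by rewrite blockD blockZ scalerDr !scalerA mulrC.
Qed.

HB.instance Definition _ a b (M : 'M[C]_a) :=
  GRing.isLinear.Build C 'M[C]_(a * b) 'M[C]_b *:%R (@pt a b M) (@pt_linear a b M).

Lemma pt_tens a b (M A : 'M[C]_a) (B : 'M[C]_b) : pt M (A *t B) = \tr (M *m A) *: B.
Proof.
rewrite trC /mxtrace scaler_suml; apply: eq_bigr => i _.
rewrite mxE scaler_suml; apply: eq_bigr => j _.
by rewrite block_tens scalerA mulrC.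
Qed.

Lemma pt_sum (I : Type) (r : seq I) a b (M : I -> 'M[C]_a) (X : 'M[C]_(a * b)) :
  \sum_(g <- r) pt (M g) X = pt (\sum_(g <- r) M g) X.
Proof.
rewrite /pt exchange_big; apply: eq_bigr => i _ /=.
rewrite exchange_big; apply: eq_bigr => j _ /=.
by rewrite summxE scaler_suml.
Qed.

Lemma ptD a b (M : 'M[C]_a) (X Y : 'M[C]_(a * b)) : pt M (X + Y) = pt M X + pt M Y.
Proof. exact: linearD. Qed.

Lemma ptZ a b (M : 'M[C]_a) c (X : 'M[C]_(a * b)) : pt M (c *: X) = c *: pt M X.
Proof. exact: linearZ. Qed.

(** Every matrix is the sum of the products [delta_mx i j *t block X i j]. Scalars sit inside the
    factors, so additivity is enough. *)
Lemma tensor_ext (V : zmodType) a b (f g : 'M[C]_(a * b) -> V) :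
  {morph f : X Y / X + Y} -> {morph g : X Y / X + Y} ->
  (forall A B, f (A *t B) = g (A *t B)) -> f =1 g.
Proof.
move=> fD gD fg X.
have f0 : f 0 = 0 by apply: (addrI (f 0)); rewrite -fD !addr0.
have g0 : g 0 = 0 by apply: (addrI (g 0)); rewrite -gD !addr0.
rewrite (block_decomp X) (big_morph f fD f0) (big_morph g gD g0).
apply: eq_bigr => i _; rewrite (big_morph f fD f0) (big_morph g gD g0).
by apply: eq_bigr.
Qed.

Lemma pt_conj a b (M A D : 'M[C]_a) (B E : 'M[C]_b) (X : 'M[C]_(a * b)) :
  pt M ((A *t B) *m X *m (D *t E)) = B *m pt (D *m M *m A) X *m E.
Proof.
move: X; apply: tensor_ext => [X Y|X Y|X Y].
- by rewrite mulmxDr mulmxDl ptD.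
- by rewrite ptD mulmxDr mulmxDl.
- rewrite !tensM !pt_tens -scalemxAr -scalemxAl; congr (_ *: _).
  by rewrite !mulmxA trC !mulmxA.
Qed.

Lemma tr_pt a b (M : 'M[C]_a) (B : 'M[C]_b) (X : 'M[C]_(a * b)) :
  \tr (B *m pt M X) = \tr ((M *t B) *m X).
Proof.
move: X; apply: tensor_ext => [X Y|X Y|X Y].
- by rewrite ptD mulmxDr mxtraceD.
- by rewrite mulmxDr mxtraceD.
- by rewrite pt_tens tensM tr_tens -scalemxAr mxtraceZ.
Qed.

Lemma tr_pt1 a b (X : 'M[C]_(a * b)) : \tr (pt 1%:M X) = \tr X.
Proof. by have := tr_pt 1%:M 1%:M X; rewrite mul1mx tensmx11 mul1mx. Qed.

(** Writing M = B^dagger B, the Kraus operators are (row c of B) (x) 1. *)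
Lemma cp_pt a b (M : 'M[C]_a) : psd M -> completely_positive (@pt a b M).
Proof.
move=> /psd_sqrt [B ->].
pose K c : 'M[C]_(b, a * b) :=
  \matrix_(r, q) (B c (mxtens_unindex q).1 * (r == (mxtens_unindex q).2)%:R).
apply: (@cp_ext _ _ (fun X => \sum_c K c *m X *m (K c)^t*)); last first.
  by apply: cp_sum => c; exact: cp_conj.
have KE c r i s : K c r (mxtens_index (i, s)) = B c i * (r == s)%:R.
  by rewrite mxE mxtens_indexK.
move: K KE => K KE X; apply/matrixP => r s; rewrite summxE /pt.
have E c : (K c *m X *m (K c)^t*) r s =
    \sum_i \sum_j B c i * (B c j)^* * X (mxtens_index (i, r)) (mxtens_index (j, s)).
  rewrite mxE sum_mxtens exchange_big /= (bigD1 s) //= [X in _ + X]big1 ?addr0; last first.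
    move=> s' /negPf s's; rewrite big1 // => j _.
    by rewrite adjE KE eq_sym s's mulr0 rmorph0 mulr0.
  rewrite [RHS]exchange_big; apply: eq_bigr => j _.
  rewrite mxE sum_mxtens mulr_suml; apply: eq_bigr => i _.
  rewrite (bigD1 r) //= big1 ?addr0; last first.
    by move=> r' /negPf r'r; rewrite KE eq_sym r'r mulr0 mul0r.
  by rewrite adjE !KE !eqxx !mulr1 mulrAC.
rewrite (eq_bigr _ (fun c _ => E c)) exchange_big summxE; apply: eq_bigr => i _ /=.
rewrite exchange_big summxE; apply: eq_bigr => j _ /=.
rewrite !mxE mulr_suml; apply: eq_bigr => c _.
by rewrite adjE [_ * B c i]mulrC.
Qed.


Lemma herm_tens_sum a b (A : 'M[C]_a) (B : 'M[C]_b) : A^t* = A -> B^t* = B ->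
  (A *t 1%:M + 1%:M *t B)^t* = A *t 1%:M + 1%:M *t B.
Proof. by move=> hA hB; rewrite adjD !adj_tens !adj1 hA hB. Qed.

Lemma unitary_conj_phase n (c : C) (A : 'M[C]_n) (X : 'M[C]_n) :
  `|c| = 1 -> (c *: A) *m X *m (c *: A)^t* = A *m X *m A^t* :> 'M[C]_n.
Proof.
by move=> c1; rewrite adjZ -!scalemxAl -scalemxAr scalerA -normCK c1 expr1n scale1r.
Qed.

Lemma evol_comm n (K U L : 'M[C]_n) t : K^t* = K -> U *m K = K *m U ->
  U *m evol K t L *m U^t* = evol K t (U *m L *m U^t*).
Proof.
move=> hK UK; rewrite !evolE // !mulmxA (prop_comm t hK UK).
by rewrite -!mulmxA -!adjM (prop_comm t hK UK).
Qed.

Lemma evol_comm_adj n (K U L : 'M[C]_n) t : K^t* = K -> U *m K = K *m U ->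
  U^t* *m evol K t L *m U = evol K t (U^t* *m L *m U).
Proof.
move=> hK UK; have h : U^t* *m K = K *m U^t* by rewrite -[in LHS]hK -adjM -UK adjM hK.
by have := evol_comm L t hK h; rewrite trmxCK.
Qed.

                                                                           
                                                                       
(** The channel measures [M] on the first factor, rotates the second by [Vb g], runs [E], discards
    the factor of dimension [q] and undoes the rotation with [Vm g]. Rotating the input by h only
    relabels the outcome g as g h, which is why the whole is covariant although [E] is not assumed
    to be. *)
Lemma twirled_channel (G : finGroupType) (a b q m : nat) (beta : R)
    (Ka : 'M[C]_a) (Kb : 'M[C]_b) (Kq : 'M[C]_q) (Km : 'M[C]_m)
    (Va : G -> 'M[C]_a) (Vb : G -> 'M[C]_b) (Vm : G -> 'M[C]_m)
    (M : G -> 'M[C]_a) (E : {linear 'M[C]_b -> 'M[C]_(q * m)}) :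
  (0 < a)%N -> (0 < q)%N ->
  Ka^t* = Ka -> Kb^t* = Kb -> Kq^t* = Kq -> Km^t* = Km ->
  proj_urep Va -> proj_urep Vb -> proj_urep Vm ->
  (forall g, Vb g *m Kb = Kb *m Vb g) -> (forall g, Vm g *m Km = Km *m Vm g) ->
  (forall g, psd (M g)) -> \sum_g M g = 1%:M ->
  (forall g, M g *m Ka = Ka *m M g) ->
  (forall g h, (Va h)^t* *m M g *m Va h = M (g * h)%g) ->
  tcgp beta Kb (Kq *t 1%:M + 1%:M *t Km) E ->
  exists E' : {linear 'M[C]_(a * b) -> 'M[C]_m},
    [/\ tcgp beta (Ka *t 1%:M + 1%:M *t Kb) Km E',
      covariant (fun g => Va g *t Vb g) Vm E'
    & forall X, E' X = \sum_g (Vm g)^t* *m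
        pt 1%:M (E (Vb g *m pt (M g) X *m (Vb g)^t*)) *m Vm g].
Proof.
move=> a0 q0 hKa hKb hKq hKm [uVa pVa] [uVb pVb] [uVm pVm] VbK VmK pM sM MK Mcov.
move=> [[cE tE] gE eE].
pose f X := \sum_g (Vm g)^t* *m
        pt 1%:M (E (Vb g *m pt (M g) X *m (Vb g)^t*)) *m Vm g.
have [E' E'E] : exists E' : {linear 'M[C]_(a * b) -> 'M[C]_m}, forall X, E' X = f X.
  apply: ex_linear => c X Y; rewrite /f scaler_sumr -big_split; apply: eq_bigr => g _ /=.
  rewrite ptD ptZ mulmxDr mulmxDl -scalemxAr -scalemxAl [E (_ + _)]linearD [E (c *: _)]linearZ /=.
  by rewrite ptD ptZ mulmxDr mulmxDl -scalemxAr -scalemxAl.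
exists E'; split=> //; last first.
(* Substituting g h for g on the right side matches the branches; the phases of the projective
   representations cancel because each meets its conjugate. *)
- move=> h X; rewrite !E'E /f mulmx_sumr mulmx_suml [RHS](reindex_inj (mulIg h)) /=.
  apply: eq_bigr => g _.
  rewrite adj_tens pt_conj Mcov.
  have [c [c1 cV]] := pVb g h; have [c' [c'1 cV']] := pVm g h.
  have -> : Vb g *m (Vb h *m pt (M (g * h)%g) X *m (Vb h)^t*) *m (Vb g)^t* =
      Vb (g * h)%g *m pt (M (g * h)%g) X *m (Vb (g * h)%g)^t*.
    by rewrite !mulmxA cV -mulmxA -adjM cV unitary_conj_phase.
  set Z := pt 1%:M _.
  have e : Vm (g * h)%g *m (Vm h)^t* = c'^* *: Vm g.
    rewrite -[RHS](mulmx_unitaryK _ (uVm h)) -[c'^* *: _ *m _]scalemxAl cV' scalerA.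
    by rewrite mulrC -normCK c'1 expr1n scale1r.
  have e2 : Vm h *m (Vm (g * h)%g)^t* = c' *: (Vm g)^t*.
    by rewrite -[Vm h in LHS]trmxCK -adjM e adjZ conjCK.
  rewrite !mulmxA e2 -mulmxA -[RHS]mulmxA e -scalemxAl -!scalemxAr -scalemxAl scalerA.
  by rewrite mulrC -normCK c'1 expr1n scale1r mulmxA.
- split.
  + split.
      apply: (@cp_ext _ _ f); first by move=> X; rewrite E'E.
      apply: cp_sum => g.
      apply: (cp_comp (F := fun X => (Vm g)^t* *m X *m Vm g)
        (E := fun X => pt 1%:M (E (Vb g *m pt (M g) X *m (Vb g)^t*)))); last first.
        by rewrite -{2}[Vm g]trmxCK; exact: cp_conj.
      apply: (cp_comp (F := pt 1%:M)); last exact: (cp_pt (psd1 _ _)).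
      apply: (cp_comp (F := E)); last exact: cE.
      apply: (cp_comp (F := fun X => Vb g *m X *m (Vb g)^t*)); last exact: cp_conj.
      exact: cp_pt.
    move=> X; rewrite E'E /f linear_sum -(tr_pt1 X) -sM -pt_sum linear_sum /=.
    apply: eq_bigr => g _.
    rewrite trC mulmxA mul_adj_unitary // mul1mx tr_pt1 tE trC mulmxA.
    by rewrite adj_mul_unitary // mul1mx.
  (* The joint Gibbs state is a product, so each branch returns the Gibbs state with weight tr (M_g
     gibbs), and these weights sum to 1. *)
  + rewrite E'E /f gibbs_tens //.
    transitivity (\sum_g \tr (M g *m gibbs beta Ka) *: gibbs beta Km).
      apply: eq_bigr => g _; rewrite pt_tens -scalemxAr -scalemxAl [E (_ *: _)]linearZ /= ptZ.
      rewrite -scalemxAr -scalemxAl; congr (_ *: _).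
      rewrite (gibbs_comm beta hKb (VbK g)) (mulmx_unitaryK _ (uVb g)) gE.
      rewrite gibbs_tens // pt_tens mul1mx (density_gibbs beta q0 hKq).2 scale1r.
      by rewrite -mulmxA -(gibbs_comm beta hKm (VmK g)) mulmxA adj_mul_unitary // mul1mx.
    rewrite -scaler_suml -linear_sum -mulmx_suml sM mul1mx.
    by rewrite /= (density_gibbs beta a0 hKa).2 scale1r.
  + move=> X t; rewrite !E'E /f evolE; last exact: herm_tens_sum.
    rewrite prop_tens // adj_tens.
    transitivity (\sum_g evol Km t ((Vm g)^t* *m
        pt 1%:M (E (Vb g *m pt (M g) X *m (Vb g)^t*)) *m Vm g)).
      apply: eq_bigr => g _.
      (* [M g] commutes with [Ka], so evolving the measured factor does not change the effect, and
         only the second factor is translated. *)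
      have WM : (propagator Ka t)^t* *m M g *m propagator Ka t = M g.
        rewrite -mulmxA (prop_comm t hKa (MK g)) mulmxA.
        by rewrite (adj_mul_unitary (prop_unitary t hKa)) mul1mx.
      rewrite pt_conj WM -evolE // evol_comm // eE.
      rewrite evolE; last exact: herm_tens_sum.
      rewrite prop_tens // adj_tens pt_conj mulmx1 adj_mul_unitary ?prop_unitary //.
      by rewrite -evolE // evol_comm_adj.
    by rewrite evolE // mulmx_sumr mulmx_suml; apply: eq_bigr => g _; rewrite evolE.
Qed.

(** The trace on the input and the Gibbs state on the output are invariant under both time
    translations and the group. This channel gives rate 0, and shows below that covariant TCGP
    operations exist for all sizes. *)
Lemma discard_channel (G : finGroupType) (n m : nat) (beta : R)
    (K : 'M[C]_n) (K' : 'M[C]_m) (V : G -> 'M[C]_n) (V' : G -> 'M[C]_m) :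
  (0 < n)%N -> (0 < m)%N -> K^t* = K -> K'^t* = K' ->
  proj_urep V -> proj_urep V' -> (forall g, V' g *m K' = K' *m V' g) ->
  exists E : {linear 'M[C]_n -> 'M[C]_m},
    [/\ tcgp beta K K' E, covariant V V' E & forall X, E X = \tr X *: gibbs beta K'].
Proof.
move=> n0 m0 hK hK' [uV _] [uV' _] V'K.
have [E EE] : exists E : {linear 'M[C]_n -> 'M[C]_m}, forall X, E X = \tr X *: gibbs beta K'.
  apply: (@ex_linear C _ _ (fun X => \tr X *: gibbs beta K')) => c X Y.
  by rewrite mxtraceD mxtraceZ scalerDl -scalerA.
have [pG tG] := density_gibbs beta m0 hK'.
exists E; split=> //; last first.
- move=> g X; rewrite !EE trC mulmxA adj_mul_unitary // mul1mx -scalemxAr -scalemxAl.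
  by rewrite (gibbs_comm beta hK' (V'K g)) (mulmx_unitaryK _ (uV' g)).
- split.
  + split; last by move=> X; rewrite EE mxtraceZ tG mulr1.
    have [B eB] := psd_sqrt pG.
    (* The Kraus operators of the map, read off from gibbs = B^dagger B. *)
    apply: (@cp_ext _ _ (fun X => \sum_i \sum_j (B^t* *m delta_mx j i) *m X *m (B^t* *m delta_mx j i)^t*)).
      move=> X; rewrite EE eB /mxtrace scaler_suml; apply: eq_bigr => i _.
      transitivity (\sum_j X i i *: (B^t* *m delta_mx j j *m B)).
        apply: eq_bigr => j _; rewrite adjM trmxCK adj_delta.
        have dX : delta_mx j i *m X *m delta_mx i j = X i i *: delta_mx j j.
          apply/matrixP => k l; rewrite mul_mx_delta delta_mul_mx !mxE.
          by rewrite mulrAC -natrM mulnb mulrC.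
        have -> : B^t* *m delta_mx j i *m X *m (delta_mx i j *m B) =
            B^t* *m (delta_mx j i *m X *m delta_mx i j) *m B by rewrite !mulmxA.
        by rewrite dX -scalemxAr -scalemxAl.
      by rewrite -scaler_sumr -mulmx_suml -mulmx_sumr -mx1_sum_delta mulmx1.
    by apply: cp_sum => i; apply: cp_sum => j; exact: cp_conj.
  + by rewrite EE (density_gibbs beta n0 hK).2 scale1r.
  + move=> X t; rewrite !EE !evolE // trC mulmxA adj_mul_unitary ?prop_unitary // mul1mx.
    rewrite -scalemxAr -scalemxAl (gibbs_comm beta hK' (esym (prop_comm t hK' (erefl _)))).
    by rewrite (mulmx_unitaryK _ (prop_unitary t hK')).
Qed.

End Channels.

                       

(** * Transport between equal dimensions; tensor powers *)

Section Casts.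
Variable C : numClosedFieldType.

(** Dimensions such as [d ^ k * d ^ l] and [d ^ (k + l)] are equal but need not be convertible. All
    transport goes through this cast, which vanishes by case analysis on the equality once an
    endpoint is general. *)
Definition cst m n (e : m = n) (A : 'M[C]_m) : 'M[C]_n := castmx (e, e) A.

Lemma cst_id m (e : m = m) A : cst e A = A.
Proof. exact: castmx_id. Qed.

Lemma cst_comp m n p (e : m = n) (f : n = p) (g : m = p) A :
  cst f (cst e A) = cst g A.
Proof. by case: _ / e f g A => f; case: _ / f => g A; rewrite !cst_id. Qed.

Lemma cstM m n (e : m = n) A B : cst e (A *m B) = cst e A *m cst e B.
Proof. by case: _ / e; rewrite !cst_id. Qed.

Lemma cstD m n (e : m = n) A B : cst e (A + B) = cst e A + cst e B.
Proof. by case: _ / e; rewrite !cst_id. Qed.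

Lemma cst1 m n (e : m = n) : cst e 1%:M = 1%:M.
Proof. by case: _ / e; rewrite !cst_id. Qed.

Lemma cst_adj m n (e : m = n) A : (cst e A)^t* = cst e (A^t*).
Proof. by case: _ / e; rewrite !cst_id. Qed.

Lemma cst_unitary m n (e : m = n) A : A \is unitarymx -> cst e A \is unitarymx.
Proof. by case: _ / e; rewrite cst_id. Qed.

Lemma cst_tensl m n p (e : m = n) (f : (m * p = n * p)%N) A (B : 'M[C]_p) :
  cst e A *t B = cst f (A *t B).
Proof. by case: _ / e f => f; rewrite !cst_id. Qed.

Lemma cst_tensr m n p (e : m = n) (f : (p * m = p * n)%N) A (B : 'M[C]_p) :
  B *t cst e A = cst f (B *t A).
Proof. by case: _ / e f => f; rewrite !cst_id. Qed.

Lemma tensA m n p (e : (m * (n * p) = m * n * p)%N)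
    (A : 'M[C]_m) (B : 'M[C]_n) (D : 'M[C]_p) :
  (A *t B) *t D = cst e (A *t (B *t D)).
Proof.
apply/matrixP => i j; rewrite castmxE /=.
case: (mxtens_indexP i) => i12 i3; case: (mxtens_indexP i12) => i1 i2 {i12}.
case: (mxtens_indexP j) => j12 j3; case: (mxtens_indexP j12) => j1 j2 {j12}.
have E (a : 'I_m) (b : 'I_n) (c : 'I_p) :
    cast_ord (esym e) (mxtens_index (mxtens_index (a, b), c)) =
    mxtens_index (a, mxtens_index (b, c)).
  by apply: val_inj; rewrite /= mulnDl mulnA addnA.
by rewrite !E !tensmxE mulrA.
Qed.

Lemma tens1_cst m (e : m = (1 * m)%N) (A : 'M[C]_m) : (1%:M : 'M[C]_1) *t A = cst e A.
Proof.
rewrite tens_scalar1mx; congr castmx; congr (_, _); exact: eq_irrelevance.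
Qed.

Lemma tensm1_cst m (e : m = (m * 1)%N) (A : 'M[C]_m) : A *t (1%:M : 'M[C]_1) = cst e A.
Proof.
rewrite tens_mx_scalar scale1r; congr castmx; congr (_, _); exact: eq_irrelevance.
Qed.

Lemma cst_udiag m n (e : m = n) (P : 'M[C]_m) a :
  cst e (udiag P a) = udiag (cst e P) (fun i => a (cast_ord (esym e) i)).
Proof.
case: _ / e; rewrite !cst_id; apply: eq_udiag => i.
by congr a; apply: val_inj.
Qed.

Lemma expn_cons d k : (d * d ^ k = d ^ k.+1)%N.
Proof. by rewrite expnS. Qed.

Lemma expn_split d k l : (d ^ k * d ^ l = d ^ (k + l))%N.
Proof. by rewrite expnD. Qed.

Lemma ntens_cons d (A : 'M[C]_d) k :
  ntensmx A k.+1 = cst (expn_cons d k) (A *t ntensmx A k).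
Proof.
(* With two or more factors the dimensions agree by computation; only [d ^ 1], which reduces to [d],
   differs from [d * d ^ 0]. *)
case: k => [|k]; last by rewrite cst_id.
rewrite -[ntensmx A 0]/(1%:M : 'M[C]_1) (tensm1_cst (esym (muln1 d))).
by rewrite (cst_comp _ _ (erefl d)) cst_id.
Qed.

Lemma ntens_ind d (Q : forall n, 'M[C]_(d ^ n) -> Prop) (A : 'M[C]_d) :
  Q 0%N (1%:M : 'M[C]_1) ->
  (forall n X, Q n X -> Q n.+1 (cst (expn_cons d n) (A *t X))) ->
  forall n, Q n (ntensmx A n).
Proof. by move=> Q0 QS; elim=> [//|n IH]; rewrite ntens_cons; exact: QS. Qed.

Lemma ntensM d (A B : 'M[C]_d) n : ntensmx A n *m ntensmx B n = ntensmx (A *m B) n.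
Proof.
elim: n => [|n IH]; first by rewrite /ntensmx mulmx1.
by rewrite !ntens_cons -cstM tensM IH.
Qed.

Lemma ntens_adj d (A : 'M[C]_d) n : (ntensmx A n)^t* = ntensmx (A^t*) n.
Proof.
elim: n => [|n IH]; first by rewrite /ntensmx adj1.
by rewrite !ntens_cons cst_adj adj_tens IH.
Qed.

Lemma ntens1 d n : ntensmx (1%:M : 'M[C]_d) n = 1%:M.
Proof. by elim: n => // n IH; rewrite ntens_cons IH tensmx11 cst1. Qed.

Lemma ntensZ d c (A : 'M[C]_d) n : ntensmx (c *: A) n = c ^+ n *: ntensmx A n.
Proof.
elim: n => [|n IH]; first by rewrite scale1r.
rewrite !ntens_cons IH tensmxZl tensmxZr scalerA -exprS.
by case: _ / (expn_cons d n); rewrite !cst_id.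
Qed.

Lemma tr_cst m n (e : m = n) A : \tr (cst e A) = \tr A.
Proof. by case: _ / e; rewrite cst_id. Qed.

Lemma tr_ntens d (A : 'M[C]_d) n : \tr (ntensmx A n) = (\tr A) ^+ n.
Proof.
elim: n => [|n IH]; first by rewrite expr0 /ntensmx mxtrace1.
by rewrite ntens_cons tr_cst tr_tens IH exprS.
Qed.

Lemma ntens_unitary d (A : 'M[C]_d) n : A \is unitarymx -> ntensmx A n \is unitarymx.
Proof.
move=> uA; apply/unitarymxP; rewrite ntens_adj ntensM mul_adj_unitary //.
exact: ntens1.
Qed.

Lemma ntens_split d (A : 'M[C]_d) k l :
  ntensmx A (k + l) = cst (expn_split d k l) (ntensmx A k *t ntensmx A l).
Proof.
elim: k => [|k IH].
  rewrite -[ntensmx A 0]/(1%:M : 'M[C]_1) (tens1_cst (esym (mul1n _))).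
  by rewrite (cst_comp _ _ (erefl _)) cst_id.
rewrite -[ntensmx A (k.+1 + l)]/(ntensmx A (k + l).+1) !ntens_cons IH.
have e1 : (d * (d ^ k * d ^ l) = d * d ^ (k + l))%N by rewrite expn_split.
have e2 : (d * d ^ k * d ^ l = d ^ k.+1 * d ^ l)%N by rewrite expn_cons.
have e3 : (d * (d ^ k * d ^ l) = d * d ^ k * d ^ l)%N by rewrite mulnA.
have e4 : (d * (d ^ k * d ^ l) = d ^ (k + l).+1)%N by rewrite e1 expn_cons.
have e5 : (d * (d ^ k * d ^ l) = d ^ k.+1 * d ^ l)%N by rewrite e3.
rewrite (cst_tensr _ e1) (cst_comp _ _ e4) (cst_tensl _ e2) (tensA e3).
by rewrite (cst_comp _ _ e5) (cst_comp _ _ e4).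
Qed.

End Casts.

(** * The Hamiltonian and the states of many copies *)

Section HamiltonianPower.
Variable R : realType.
Local Notation C := (Cx R).

Lemma tens_family_cons d (A : nat -> 'M[C]_d) k :
  tens_family A k.+1 = cst (expn_cons d k) (A 0%N *t tens_family (fun i => A i.+1) k).
Proof.
case: k => [|k]; last by rewrite cst_id.
rewrite -[tens_family _ 0]/(1%:M : 'M[C]_1) (tensm1_cst (esym (muln1 d))).
by rewrite (cst_comp _ _ (erefl d)) cst_id.
Qed.

Lemma tens_family1 d n : tens_family (fun=> (1%:M : 'M[C]_d)) n = 1%:M.
Proof. by rewrite tens_family_cst ntens1. Qed.

Lemma hamn0 d (H : 'M[C]_d) : hamn H 0 = 0.
Proof. by rewrite /hamn big_ord0. Qed.

Lemma cst_sum (I : Type) (r : seq I) m n (e : m = n) (F : I -> 'M[C]_m) :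
  cst e (\sum_(i <- r) F i) = \sum_(i <- r) cst e (F i).
Proof.
by case: _ / e; rewrite cst_id; apply: eq_bigr => i _; rewrite cst_id.
Qed.

Lemma hamn_cons d (H : 'M[C]_d) n :
  hamn H n.+1 = cst (expn_cons d n) (H *t 1%:M + 1%:M *t hamn H n).
Proof.
rewrite cstD /hamn big_ord_recl tensmx_sumr cst_sum -(tens_family1 d n).
by congr (_ + _); [|apply: eq_bigr => j _]; exact: tens_family_cons.
Qed.

Lemma hamn_herm d (H : 'M[C]_d) n : H^t* = H -> (hamn H n)^t* = hamn H n.
Proof.
move=> hH; elim: n => [|n IH]; first by rewrite hamn0 trmx0 map_mx0.
by rewrite hamn_cons cst_adj herm_tens_sum.
Qed.

Lemma hamn_split d (H : 'M[C]_d) k l :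
  hamn H (k + l) = cst (expn_split d k l) (hamn H k *t 1%:M + 1%:M *t hamn H l).
Proof.
elim: k => [|k IH].
  rewrite hamn0 tens0mx add0r -[(1%:M : 'M[C]_(d ^ 0))]/(1%:M : 'M[C]_1) (tens1_cst (esym (mul1n _))).
  by rewrite (cst_comp _ _ (erefl _)) cst_id.
rewrite -[hamn H (k.+1 + l)]/(hamn H (k + l).+1) !hamn_cons IH.
have e1 : (d * (d ^ k * d ^ l) = d * d ^ (k + l))%N by rewrite expn_split.
have e2 : (d * d ^ k * d ^ l = d ^ k.+1 * d ^ l)%N by rewrite expn_cons.
have e3 : (d * (d ^ k * d ^ l) = d * d ^ k * d ^ l)%N by rewrite mulnA.
have e4 : (d * (d ^ k * d ^ l) = d ^ (k + l).+1)%N by rewrite e1 expn_cons.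
have e5 : (d * (d ^ k * d ^ l) = d ^ k.+1 * d ^ l)%N by rewrite e3.
rewrite -[in LHS](cst1 C (expn_split d k l)) !(cst_tensr _ e1) -cstD (cst_comp _ _ e4).
have -> : (1%:M : 'M[C]_(d ^ k.+1)) *t hamn H l = cst e2 (1%:M *t hamn H l).
  by rewrite -(cst_tensl (expn_cons d k) e2) cst1.
rewrite (cst_tensl _ e2) -cstD.
have -> : (1%:M : 'M[C]_(d * d ^ k)) *t hamn H l = cst e3 (1%:M *t (1%:M *t hamn H l)).
  by rewrite -tensA tensmx11.
rewrite (tensmxDl (H *t 1%:M)) !(tensA e3) -!cstD (cst_comp _ _ e5) (cst_comp _ _ e4).
by rewrite tensmx11 tensmxDr addrA.
Qed.

Lemma hamn_comm d (U H : 'M[C]_d) n : U *m H = H *m U ->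
  ntensmx U n *m hamn H n = hamn H n *m ntensmx U n.
Proof.
move=> UH; elim: n => [|n IH]; first by rewrite hamn0 mulmx0 mul0mx.
by rewrite ntens_cons hamn_cons -!cstM mulmxDr mulmxDl !tensM !mulmx1 !mul1mx UH IH.
Qed.

Lemma prop0 n t : propagator (0 : 'M[C]_n) t = 1%:M.
Proof.
have u1 : (1%:M : 'M[C]_n) \is unitarymx by apply/unitarymxP; rewrite adj1 mulmx1.
have -> : (0 : 'M[C]_n) = udiag 1%:M (fun=> rc 0).
  by apply/matrixP => i j; rewrite udiagE mxE big1 // => k _; rewrite mulr0 mul0r.
rewrite (prop_udiag (fun=> 0) t u1) -[RHS](udiag1 u1); apply: eq_udiag => i.
by rewrite mulr0 oppr0 cis0.
Qed.

Lemma prop_cst m n (e : m = n) (K : 'M[C]_m) t : propagator (cst e K) t = cst e (propagator K t).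
Proof. by case: _ / e; rewrite !cst_id. Qed.

Lemma prop_hamn d (H : 'M[C]_d) n t : H^t* = H ->
  propagator (hamn H n) t = ntensmx (propagator H t) n.
Proof.
move=> hH; elim: n => [|n IH]; first by rewrite hamn0 prop0.
by rewrite hamn_cons ntens_cons prop_cst prop_tens ?hamn_herm // IH.
Qed.

Lemma evol_hamn d (H rho : 'M[C]_d) n t : H^t* = H ->
  evol (hamn H n) t (ntensmx rho n) = ntensmx (evol H t rho) n.
Proof.
move=> hH; by rewrite !evolE ?hamn_herm // prop_hamn // ntens_adj !ntensM.
Qed.

(** The integer m_i counts the copies in level i. As m_i <= n, there are at most (n+1)^d distinct
    energies, the polynomial count on which the pinching estimate rests. *)
Lemma hamn_spectrum d (P : 'M[C]_d) (l : 'I_d -> R) n : P \is unitarymx ->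
  exists Q : 'M[C]_(d ^ n), exists lam : 'I_(d ^ n) -> R,
    [/\ Q \is unitarymx,
        hamn (udiag P (fun i => rc (l i))) n = udiag Q (fun i => rc (lam i))
      & forall k, exists m : {ffun 'I_d -> 'I_n.+1}, lam k = \sum_i (m i)%:R * l i].
Proof.
move=> uP; elim: n => [|n [Q [lam [uQ eQ hlam]]]].
  have u1 : (1%:M : 'M[C]_1) \is unitarymx by apply/unitarymxP; rewrite adj1 mulmx1.
  exists (1%:M : 'M[C]_1), (fun=> 0); split=> //.
    rewrite hamn0; apply/matrixP => i j; rewrite udiagE mxE big1 // => k _.
    by rewrite mulr0 mul0r.
  by move=> k; exists [ffun=> ord0]; rewrite big1 // => i _; rewrite ffunE mul0r.
exists (cst (expn_cons d n) (P *t Q)).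
exists (fun i => l (mxtens_unindex (cast_ord (esym (expn_cons d n)) i)).1 +
  lam (mxtens_unindex (cast_ord (esym (expn_cons d n)) i)).2); split.
- by rewrite cst_unitary // unitary_tens.
- rewrite hamn_cons eQ (tens_udiag_sum _ _ uP uQ) cst_udiag; apply: eq_udiag => i.
  by rewrite rcD.
- move=> k; set i0 := (mxtens_unindex _).1; set k0 := (mxtens_unindex _).2.
  have [m em] := hlam k0.
  (* The occupation numbers are at most n, hence at most n + 1 after adding one copy in level [i0],
     so [inord] does not truncate. *)
  exists [ffun i => inord ((i == i0) + m i)]; rewrite em.
  rewrite (bigD1 i0) //= [RHS](bigD1 i0) //= ffunE eqxx inordK; last by rewrite ltnS.
  rewrite natrD mulrDl mul1r addrA; congr (_ + _); apply: eq_bigr => i /negPf ii.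
  by rewrite ffunE ii add0n inordK // (leq_trans (ltn_ord (m i))).
Qed.

Lemma psd_ntens d (A : 'M[C]_d) n : psd A -> psd (ntensmx A n).
Proof.
move=> pA; apply: (@ntens_ind _ _ (fun n X => psd X)); first exact: psd1.
move=> k X pX; case: _ / (expn_cons d k); rewrite cst_id; exact: psd_tens pA pX.
Qed.

Lemma density_ntens d (A : 'M[C]_d) n : density A -> density (ntensmx A n).
Proof. by move=> [pA tA]; split; [exact: psd_ntens | rewrite tr_ntens tA expr1n]. Qed.

Lemma proj_urep_ntens (G : finGroupType) d (U : G -> 'M[C]_d) n :
  proj_urep U -> proj_urep (fun g => ntensmx (U g) n).
Proof.
move=> [uU pU]; split=> [g|g h]; first exact: ntens_unitary.
have [c [c1 cU]] := pU g h; exists (c ^+ n).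
by rewrite normrX c1 expr1n ntensM cU ntensZ.
Qed.

End HamiltonianPower.

                 

(** * Pinching as an algebraic identity *)

Section PinchingAlgebra.
Variables (F : numClosedFieldType) (T : eqType) (n : nat).
Variables (P : T -> 'M[F]_n) (es : seq T).
Hypothesis P_adj : forall x, (P x)^t* = P x.
Implicit Type X : 'M[F]_n.

(** The pinching inequality in disguise: for psd [X] the right side is visibly psd. In its expansion
    the diagonal terms give twice the first term, and the cross terms sum to 2 (sum P) X (sum P) = 2
    X. *)
Lemma pinch_sum_sub X : \sum_(x <- es) P x = 1%:M ->
  (size es)%:R *: (\sum_(x <- es) P x *m X *m P x) - X =
  2^-1 *: \sum_(x <- es) \sum_(y <- es) (P x - P y) *m X *m (P x - P y)^t*.
Proof.
move=> sP.
have E x y : (P x - P y) *m X *m (P x - P y)^t* =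
    P x *m X *m P x + P y *m X *m P y - (P x *m X *m P y + P y *m X *m P x).
  rewrite adjB !P_adj !mulmxBl !mulmxBr.
  by apply/matrixP => i j; rewrite !mxE; ring.
under [in RHS]eq_bigr do under eq_bigr do rewrite E.
have S1 : \sum_(x <- es) \sum_(y <- es) P x *m X *m P x =
    (size es)%:R *: (\sum_(x <- es) P x *m X *m P x).
  rewrite scaler_sumr; apply: eq_bigr => x _.
  by rewrite big_const_seq count_predT iter_addr_0 scaler_nat.
have S2 : \sum_(x <- es) \sum_(y <- es) P y *m X *m P y =
    (size es)%:R *: (\sum_(x <- es) P x *m X *m P x).
  by rewrite exchange_big.
have S3 : \sum_(x <- es) \sum_(y <- es) P x *m X *m P y = X.
  transitivity ((\sum_(x <- es) P x) *m X *m (\sum_(x <- es) P x)).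
    rewrite !mulmx_suml; apply: eq_bigr => x _.
    by rewrite mulmx_sumr.
  by rewrite sP mul1mx mulmx1.
have S4 : \sum_(x <- es) \sum_(y <- es) P y *m X *m P x = X by rewrite exchange_big.
under [in RHS]eq_bigr do rewrite sumrB !big_split /=.
rewrite sumrB !big_split /= S1 S2 S3 S4 -!mulr2n -mulrnBl -[(_ - _) *+ 2]scaler_nat scalerA.
by rewrite mulVf ?scale1r // pnatr_eq0.
Qed.

Lemma pinch_sum_comm K X (c : T -> F) :
  (forall x, P x *m K = c x *: P x) -> (forall x, K *m P x = c x *: P x) ->
  (\sum_(x <- es) P x *m X *m P x) *m K = K *m (\sum_(x <- es) P x *m X *m P x).
Proof.
move=> h1 h2; rewrite mulmx_suml mulmx_sumr; apply: eq_bigr => x _.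
by rewrite -mulmxA h1 !mulmxA h2 -scalemxAr -!scalemxAl.
Qed.

(** Orthogonality of the phases over the list [ts] kills the cross terms P_x X P_y with x <> y. *)
Lemma pinch_sum_average (I : Type) (ts : seq I) (z : I -> T -> F) X : uniq es ->
  (forall x y, x \in es -> y \in es ->
     \sum_(t <- ts) z t x * (z t y)^* = (size ts * (x == y))%:R) ->
  (size ts)%:R *: (\sum_(x <- es) P x *m X *m P x) =
  \sum_(t <- ts) (\sum_(x <- es) z t x *: P x) *m X *m
     (\sum_(x <- es) z t x *: P x)^t*.
Proof.
move=> ues hz.
have E t : (\sum_(x <- es) z t x *: P x) *m X *m (\sum_(x <- es) z t x *: P x)^t* =
    \sum_(x <- es) \sum_(y <- es) (z t x * (z t y)^*) *: (P x *m X *m P y).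
  rewrite !mulmx_suml; apply: eq_bigr => x _.
  rewrite adj_sum mulmx_sumr; apply: eq_bigr => y _.
  by rewrite adjZ P_adj -!scalemxAl -scalemxAr scalerA.
under [RHS]eq_bigr do rewrite E.
rewrite exchange_big /= scaler_sumr [LHS]big_seq [RHS]big_seq.
apply: eq_bigr => x xes; rewrite exchange_big /=.
transitivity (\sum_(y <- es) (size ts * (x == y))%:R *: (P x *m X *m P y)).
  rewrite (bigD1_seq x) //= eqxx muln1 big1 ?addr0 // => y /negPf yx.
  by rewrite eq_sym yx muln0 scale0r.
by rewrite [LHS]big_seq [RHS]big_seq; apply: eq_bigr => y yes; rewrite -scaler_suml hz.
Qed.

End PinchingAlgebra.

(** * Pinching to energy spaces and the time-invariant test *)

Section Pinching.
Variable R : realType.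
Local Notation C := (Cx R).

                                                                              
(** Adjoining to [ts] its translate by pi / y multiplies each sum by 1 + e^{i pi x / y}, which
    vanishes at x = y and preserves the zeros already obtained. A finite average over these times
    replaces a long-time average. *)
Lemma vanishing_times (ns : seq R) : exists ts : seq R, (0 < size ts)%N /\
  forall x, x \in ns -> x != 0 -> \sum_(t <- ts) cis (t * x) = 0.
Proof.
elim: ns => [|y ns [ts [ts0 hts]]]; first by exists [:: 0].
have [->|y0] := eqVneq y 0.
  exists ts; split=> // x; rewrite inE => /orP[/eqP -> /eqP //|]; exact: hts.
exists (ts ++ [seq t + pi / y | t <- ts]); split=> [|x].
  by rewrite size_cat addn_gt0 ts0.
have -> : \sum_(t <- ts ++ [seq t + pi / y | t <- ts]) cis (t * x) =
    (\sum_(t <- ts) cis (t * x)) * (1 + cis (pi / y * x)).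
  rewrite big_cat /= big_map mulrDr mulr1; congr (_ + _); rewrite mulr_suml.
  by apply: eq_bigr => t _; rewrite mulrDl cisD.
rewrite inE => /orP[/eqP -> _|xns x0]; last by rewrite (hts _ xns x0) mul0r.
by rewrite divfK // cispi subrr mulr0.
Qed.

Definition eigenvalues n (lam : 'I_n -> R) : seq R := undup [seq lam k | k <- enum 'I_n].

Definition eigenproj n (Q : 'M[C]_n) (lam : 'I_n -> R) (x : R) : 'M[C]_n :=
  udiag Q (fun k => (lam k == x)%:R).

Lemma eigenproj_sum n (Q : 'M[C]_n) (lam : 'I_n -> R) (f : R -> C) :
  \sum_(x <- eigenvalues lam) f x *: eigenproj Q lam x = udiag Q (fun k => f (lam k)).
Proof.
under eq_bigr do rewrite /eigenproj udiagZ.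
rewrite udiag_sum; apply: eq_udiag => k.
rewrite (bigD1_seq (lam k)) /= ?undup_uniq //; last first.
  by rewrite mem_undup; apply/mapP; exists k => //; rewrite mem_enum.
rewrite eqxx mulr1 big1 ?addr0 // => x /negPf xk.
by rewrite eq_sym xk mulr0.
Qed.

Lemma eigenproj_adj n (Q : 'M[C]_n) lam x : (eigenproj Q lam x)^t* = eigenproj Q lam x.
Proof. by rewrite /eigenproj udiag_adj; apply: eq_udiag => k; rewrite rmorph_nat. Qed.

Lemma eigenproj_mul n (Q : 'M[C]_n) lam x : Q \is unitarymx ->
  eigenproj Q lam x *m udiag Q (fun k => rc (lam k)) = rc x *: eigenproj Q lam x /\
  udiag Q (fun k => rc (lam k)) *m eigenproj Q lam x = rc x *: eigenproj Q lam x.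
Proof.
move=> uQ; rewrite /eigenproj !udiagM // udiagZ; split; apply: eq_udiag => k.
  by case: eqP => [->|_]; rewrite ?mul1r ?mulr1 ?mul0r ?mulr0.
by case: eqP => [->|_]; rewrite ?mul1r ?mulr1 ?mul0r ?mulr0.
Qed.

(** Pinching by the spectral projections of the matrix with eigenvalues [lam] in the basis [Q];
    [eigenvalues] lists each value once, so the projections sum to 1. *)
Definition pinch n (Q : 'M[C]_n) (lam : 'I_n -> R) (X : 'M[C]_n) : 'M[C]_n :=
  \sum_(x <- eigenvalues lam) eigenproj Q lam x *m X *m eigenproj Q lam x.

Lemma psd_pinch n (Q : 'M[C]_n) lam X : psd X -> psd (pinch Q lam X).
Proof.
move=> pX; apply: psd_sum => x _.
by rewrite -{2}(eigenproj_adj Q lam x); exact: (psd_conj _ pX).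
Qed.

Lemma pinch_comm n (Q : 'M[C]_n) lam X : Q \is unitarymx ->
  pinch Q lam X *m udiag Q (fun k => rc (lam k)) =
  udiag Q (fun k => rc (lam k)) *m pinch Q lam X.
Proof.
move=> uQ; apply: (@pinch_sum_comm C _ _ _ _ _ _ (@rc R)) => x.
  exact: (eigenproj_mul lam x uQ).1.
exact: (eigenproj_mul lam x uQ).2.
Qed.

Lemma pinching_inequality n (Q : 'M[C]_n) lam X : Q \is unitarymx -> psd X ->
  psd ((size (eigenvalues lam))%:R *: pinch Q lam X - X).
Proof.
move=> uQ pX; rewrite /pinch pinch_sum_sub; last first.
- rewrite -(udiag1 uQ) -(eigenproj_sum Q lam (fun=> 1)).
  by apply: eq_bigr => x _; rewrite scale1r.
- by move=> x; exact: eigenproj_adj.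
apply: psdZ; first by rewrite invr_ge0 ler0n.
by apply: psd_sum => x _; apply: psd_sum => y _; exact: (psd_conj _ pX).
Qed.

(** Evolution multiplies P_x X P_y by e^{it(y-x)}, so times that cancel all nonzero energy
    differences leave only the diagonal blocks. *)
Lemma pinch_average n (Q : 'M[C]_n) lam X : Q \is unitarymx ->
  exists ts : seq R, (0 < size ts)%N /\
   (size ts)%:R *: pinch Q lam X =
   \sum_(t <- ts) evol (udiag Q (fun k => rc (lam k))) t X.
Proof.
move=> uQ.
have [ts [ts0 hts]] :=
  vanishing_times [seq y - x | x <- eigenvalues lam, y <- eigenvalues lam].
exists ts; split=> //.
have hK : (udiag Q (fun k => rc (lam k)))^t* = udiag Q (fun k => rc (lam k)).
  by rewrite udiag_adj; apply: eq_udiag => k; rewrite rc_conj.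
rewrite /pinch (@pinch_sum_average C _ _ _ _ (eigenproj_adj Q lam) _ ts
  (fun t x => cis (- (t * x)))).
- apply: eq_bigr => t _; rewrite (evolE _ _ hK) (prop_udiag _ _ uQ).
  by rewrite (eigenproj_sum Q lam (fun x => cis (- (t * x)))).
- exact: undup_uniq.
- move=> x y xes yes.
  transitivity (\sum_(t <- ts) cis (t * (y - x))).
    apply: eq_bigr => t _; rewrite cis_conj opprK -cisD.
    by congr cis; rewrite mulrBr addrC.
  have [->|xy] := eqVneq x y.
    rewrite (eq_bigr (fun=> 1)) => [|t _]; last by rewrite subrr mulr0 cis0.
    by rewrite big_const_seq count_predT iter_addr_0 muln1.
  rewrite muln0 hts //; last by rewrite subr_eq0 eq_sym.
  by apply/allpairsP; exists (x, y).
Qed.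

Lemma size_eigenvalues n (lam : 'I_n -> R) (T : finType) (f : T -> R) :
  (forall k, exists x, lam k = f x) -> (size (eigenvalues lam) <= #|T|)%N.
Proof.
move=> h; rewrite cardE -(size_map f); apply: uniq_leq_size; first exact: undup_uniq.
move=> y; rewrite mem_undup => /mapP[k _ ->]; have [x ->] := h k.
by apply: map_f; rewrite mem_enum.
Qed.

Lemma psd_evol n (K X : 'M[C]_n) t : K^t* = K -> psd X -> psd (evol K t X).
Proof. by move=> hK pX; rewrite (evolE _ _ hK); exact: (psd_conj _ pX). Qed.

(** [M] is the pinched power of [rho]. The lower bound pairs the pinching inequality with
    [ntensmx rho k] and counts energies; the upper bound writes [M] as an average of powers of time
    translates of [rho]. *)
Lemma invariant_test d (H rho : 'M[C]_d) k : H^t* = H -> psd rho ->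
  exists M : 'M[C]_(d ^ k), [/\ psd M, M *m hamn H k = hamn H k *m M,
    (\tr (rho *m rho)) ^+ k <= (k.+1 ^ d)%:R * \tr (M *m ntensmx rho k)
  & forall (tau : 'M[C]_d) (e : R), psd tau ->
      (forall t, \tr (evol H t rho *m tau) <= rc e) ->
      \tr (M *m ntensmx tau k) <= rc (e ^+ k)].
Proof.
move=> hH pr; have [P [l [uP eH]]] := herm_udiag hH.
have [Q [lam [uQ eHk hlam]]] := hamn_spectrum l k uP; rewrite -eH in eHk.
have prk : psd (ntensmx rho k) by exact: psd_ntens pr.
exists (pinch Q lam (ntensmx rho k)); split.
- exact: psd_pinch.
- rewrite eHk; exact: pinch_comm.
- have := tr_psdM_ge0 (pinching_inequality lam uQ prk) prk.
  rewrite mulmxBl mxtraceD -scalemxAl mxtraceZ linearN /= subr_ge0 ntensM tr_ntens => h.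
  apply: (le_trans h); apply: ler_wpM2r; first exact: (tr_psdM_ge0 (psd_pinch _ _ prk) prk).
  rewrite ler_nat.
  have := @size_eigenvalues _ lam {ffun 'I_d -> 'I_k.+1} (fun m => \sum_i (m i)%:R * l i) hlam.
  by rewrite card_ffun !card_ord.
- move=> tau e pt ht.
  have [ts [ts0 ets]] := pinch_average lam (ntensmx rho k) uQ.
  have ts0' : 0 < (size ts)%:R :> C by rewrite ltr0n.
  rewrite -(ler_pM2l ts0') -mxtraceZ scalemxAl ets mulmx_suml raddf_sum /=.
  apply: (@le_trans _ _ (\sum_(t <- ts) rc (e ^+ k))); last first.
    by rewrite big_const_seq count_predT iter_addr_0 mulr_natl.
  apply: ler_sum => t _; rewrite -eHk evol_hamn // ntensM tr_ntens rcX.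
  apply: lerXn2r; rewrite ?nnegrE.
  + exact: (tr_psdM_ge0 (psd_evol t hH pr) pt).
  + exact: (le_trans (tr_psdM_ge0 (psd_evol t hH pr) pt) (ht t)).
  + exact: ht.
Qed.

End Pinching.

(** * Geometric decay beats polynomial growth *)

Section PolynomialGeometric.
Variable R : realType.

Lemma geometric_bound (y : R) k : 0 <= y -> y <= 1 ->
  k.+1%:R * y ^+ k * (1 - y) <= 1.
Proof.
(* A strengthening fit for induction: the new left side is nonincreasing in k. *)
move=> y0 y1; suff h : k.+1%:R * y ^+ k * (1 - y) + y ^+ k.+1 <= 1.
  by apply: le_trans h; rewrite lerDl exprn_ge0.
elim: k => [|k IH]; first by rewrite expr0 expr1 !mul1r subrK.
apply: le_trans IH.
have -> : k.+2%:R * y ^+ k.+1 * (1 - y) + y ^+ k.+2 =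
    y * (k.+1%:R * y ^+ k * (1 - y)) + y ^+ k.+1.
  by rewrite -[k.+2%:R]natr1 !exprS; ring.
rewrite lerD2r ler_piMl // !mulr_ge0 ?subr_ge0 // ?exprn_ge0 //.
Qed.

(** Write x^k = y^k y^k with y = sqrt x: by induction one factor absorbs (k+1)^d, and the other
    absorbs the additional k+1. *)
Lemma poly_geometric_bounded (x : R) d : 0 <= x -> x < 1 ->
  exists2 B : R, 0 < B & forall k : nat, k.+1%:R ^+ d * x ^+ k <= B.
Proof.
elim: d x => [|d IH] x x0 x1.
  by exists 1 => // k; rewrite expr0 mul1r exprn_ile1 // ltW.
have [y ey] : {y | y = Num.sqrt x} by exists (Num.sqrt x).
have y0 : 0 <= y by rewrite ey sqrtr_ge0.
have y1 : y < 1 by rewrite ey -[ltRHS]sqrtr1 ltr_sqrt.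
have [B B0 hB] := IH y y0 y1; exists (B / (1 - y)) => [|k].
  by rewrite divr_gt0 // subr_gt0.
have -> : x ^+ k = y ^+ k * y ^+ k by rewrite -expr2 -exprM mulnC exprM ey sqr_sqrtr.
rewrite ler_pdivlMr ?subr_gt0 // exprS.
have -> : k.+1%:R * k.+1%:R ^+ d * (y ^+ k * y ^+ k) * (1 - y) =
  (k.+1%:R ^+ d * y ^+ k) * (k.+1%:R * y ^+ k * (1 - y)) by ring.
rewrite -[leRHS]mulr1; apply: ler_pM => //.
- by rewrite mulr_ge0 ?exprn_ge0.
- by rewrite !mulr_ge0 ?exprn_ge0 // subr_ge0 ltW.
- by apply: geometric_bound => //; exact: ltW.
Qed.

(** The bound for degree d + 1 leaves a spare factor 1 / (k+1). *)
Lemma poly_geometric_small (x : R) d (e : R) : 0 <= x -> x < 1 -> 0 < e ->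
  exists k : nat, k.+1%:R ^+ d * x ^+ k <= e.
Proof.
move=> x0 x1 e0; have [B B0 hB] := poly_geometric_bounded d.+1 x0 x1.
exists (Num.truncn (B / e)).
have := hB (Num.truncn (B / e)); set k := Num.truncn _ => h.
have kB : B / e < k.+1%:R by rewrite truncnS_gt.
have k0 : 0 < k.+1%:R :> R by rewrite ltr0n.
rewrite -(ler_pM2l k0) mulrA -exprS; apply: (le_trans h).
by rewrite -ler_pdivrMr // ltW.
Qed.

End PolynomialGeometric.

                                            

(** * Covariant, time-invariant measurements of the group element *)

Lemma trB (F : numClosedFieldType) n (A B : 'M[F]_n) : \tr (A - B) = \tr A - \tr B.
Proof. exact: raddfB. Qed.

Lemma tr_suml (F : numClosedFieldType) (I : finType) n (A : I -> 'M[F]_n) (X : 'M[F]_n) :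
  \tr ((\sum_i A i) *m X) = \sum_i \tr (A i *m X).
Proof. by rewrite mulmx_suml; exact: raddf_sum. Qed.

Section Povm.
Variables (R : realType) (G : finGroupType) (d : nat).
Local Notation C := (Cx R).
Variables (U : G -> 'M[C]_d) (H rho : 'M[C]_d) (bad : pred G).
Hypotheses (U_rep : proj_urep U) (H_herm : H^t* = H) (rho_density : density rho).
Hypothesis U_comm : forall g, U g *m H = H *m U g.

(** By the last clause, outcome g on copies of U(h) rho U(h)^dagger is as likely as outcome g h on
    copies of rho: g guesses the inverse of the rotation undergone by the input. *)
Definition covariant_povm k (M : G -> 'M[C]_(d ^ k)) : Prop :=
  [/\ forall g, psd (M g), \sum_g M g = 1%:M,
      forall g, M g *m hamn H k = hamn H k *m M g
    & forall g h, (ntensmx (U h) k)^t* *m M g *m ntensmx (U h) k = M (g * h)%g].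

Definition povm_error k (M : G -> 'M[C]_(d ^ k)) : C :=
  \sum_(g | bad g) \tr (M g *m ntensmx rho k).

Lemma sum_bad_le (x : C) : 0 <= x -> \sum_(g | bad g) x <= #|G|%:R * x.
Proof.
move=> x0; rewrite mulr_natl -sumr_const.
rewrite [leRHS](bigID bad) /= (eq_bigl (fun g => (g \in G) && bad g)) //.
by rewrite lerDl sumr_ge0.
Qed.

Lemma trivial_povm k : exists2 M : G -> 'M[C]_(d ^ k),
  covariant_povm M & povm_error M <= rc 1.
Proof.
have G0 : (#|G|%:R : C) != 0 by rewrite pnatr_eq0 -lt0n; apply/card_gt0P; exists 1%g.
exists (fun=> #|G|%:R^-1 *: 1%:M).
  split.
  - by move=> g; apply: psdZ; [rewrite invr_ge0 ler0n|exact: psd1].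
  - by rewrite sumr_const -scaler_nat scalerA mulfV // scale1r.
  - by move=> g; rewrite -scalemxAl -scalemxAr mul1mx mulmx1.
  - move=> g h; rewrite -scalemxAr -scalemxAl mulmx1.
    by rewrite (adj_mul_unitary (ntens_unitary k (U_rep.1 h))).
rewrite /povm_error.
under eq_bigr do rewrite -scalemxAl mul1mx mxtraceZ (density_ntens k rho_density).2 mulr1.
apply: le_trans (sum_bad_le _) _; first by rewrite invr_ge0 ler0n.
by rewrite mulfV.
Qed.

(** An eigenvalue is at most the sum of all of them. This is what makes the rescaled effects of
    [round_effects] sum to at most 1. *)
Lemma psd_le_trace n (A : 'M[C]_n) : psd A -> psd ((\tr A)%:M - A).
Proof.
move=> /psd_diagP [P [l [uP -> l0]]].
have eA : P^t* *m diag_mx (\row_i rc (l i)) *m P = udiag P (fun i => rc (l i)).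
  by rewrite udiag_def.
rewrite eA tr_udiag // -scalemx1 -[X in _ *: X](udiag1 uP) udiagZ.
rewrite -[udiag P (fun i => rc (l i))]scale1r -[X in _ - X]opprK opprK -scaleNr udiagZ udiagD.
rewrite (@eq_udiag _ _ _ _ (fun i => rc (\sum_(j | j != i) l j))).
  by apply: psd_udiag => i; exact: sumr_ge0.
move=> i; by rewrite mulr1 mulN1r -rc_sum (bigD1 i) //= rcD addrAC subrr add0r.
Qed.

(** A projective representation fixes U(1) only up to a phase, which cancels in the conjugation. *)
Lemma unit_rep_conj : U 1%g *m rho *m (U 1%g)^t* = rho.
Proof.
have [uU pU] := U_rep; have [c [c1 e]] := pU 1%g 1%g.
have -> : U 1%g = c *: 1%:M.
  by rewrite -[LHS](mulmx_unitaryK _ (uU 1%g)) e mulg1 -scalemxAl mul_adj_unitary.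
by rewrite (unitary_conj_phase _ _ c1) adj1 mul1mx mulmx1.
Qed.

(** The effects are the rotated tests V_g^dagger T V_g divided by the trace of their sum. The
    success probability [s] may be tiny; what matters is that a bad outcome has weight at most
    [eta * s], small compared with [s]. *)
Lemma round_effects k0 (T : 'M[C]_(d ^ k0)) (eta : R) : 0 <= eta ->
  psd T -> T *m hamn H k0 = hamn H k0 *m T ->
  0 < \tr (T *m ntensmx rho k0) ->
  (forall g, bad g -> \tr (T *m ntensmx (U g *m rho *m (U g)^t*) k0) <=
     rc eta * \tr (T *m ntensmx rho k0)) ->
  exists (N : G -> 'M[C]_(d ^ k0)) (s : R),
    [/\ forall g, psd (N g), psd (1%:M - \sum_g N g),
      forall g, N g *m hamn H k0 = hamn H k0 *m N g
    & forall g h, (ntensmx (U h) k0)^t* *m N g *m ntensmx (U h) k0 = N (g * h)%g] /\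
    [/\ 0 < s, \sum_g \tr (N g *m ntensmx rho k0) = rc s
    & forall g, bad g -> \tr (N g *m ntensmx rho k0) <= rc (eta * s)].
Proof.
move=> eta0 pT TH trT0 trTbad.
have [uV pV] := proj_urep_ntens k0 U_rep.
have [V VE] : {V | forall g, V g = ntensmx (U g) k0} by exists (fun g => ntensmx (U g) k0).
have VH g : V g *m hamn H k0 = hamn H k0 *m V g by rewrite VE; exact: hamn_comm.
have VHa g : (V g)^t* *m hamn H k0 = hamn H k0 *m (V g)^t*.
  by rewrite -{1}(hamn_herm k0 H_herm) -adjM -VH adjM (hamn_herm k0 H_herm).
have [prk trk] := density_ntens k0 rho_density.
have [A AE] : {A | forall g, A g = (V g)^t* *m T *m V g}.
  by exists (fun g => (V g)^t* *m T *m V g).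
have pA g : psd (A g) by rewrite AE -{2}[V g]trmxCK; exact: (psd_conj _ pT).
have trA g : \tr (A g *m ntensmx rho k0) = \tr (T *m ntensmx (U g *m rho *m (U g)^t*) k0).
  by rewrite AE -!ntensM -ntens_adj -VE -!mulmxA trC !mulmxA.
have trA0 g : 0 <= \tr (A g *m ntensmx rho k0) by exact: (tr_psdM_ge0 (pA g) prk).
have pS : psd (\sum_g A g) by apply: psd_sum => g _; exact: pA.
have [Z eZ] : {Z | Z = \tr (\sum_g A g)} by exists (\tr (\sum_g A g)).
have Z0 : 0 < Z.
  have := tr_psdM_ge0 (psd_le_trace pS) prk.
  rewrite mulmxBl mul_scalar_mx trB mxtraceZ trk mulr1 subr_ge0 -eZ.
  apply: lt_le_trans; rewrite tr_suml (bigD1 1%g) //=.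
  by rewrite trA unit_rep_conj ltr_wpDr // sumr_ge0.
have iZ0 : 0 <= Z^-1 by rewrite invr_ge0 ltW.
have trN g : \tr ((Z^-1 *: A g) *m ntensmx rho k0) = Z^-1 * \tr (A g *m ntensmx rho k0).
  by rewrite -scalemxAl mxtraceZ.
have es : \sum_g Z^-1 * \tr (A g *m ntensmx rho k0) =
    rc (complex.Re (\sum_g Z^-1 * \tr (A g *m ntensmx rho k0))).
  by apply: rc_Re; apply: sumr_ge0 => g _; rewrite mulr_ge0.
move: (complex.Re _) es => s es.
(* The outcome 1 alone already contributes this much to [s], which turns bounds relative to tr (T
   rho^k0) into bounds relative to [s]. *)
have n1 : Z^-1 * \tr (T *m ntensmx rho k0) <= rc s.
  rewrite -es (bigD1 1%g) //= trA unit_rep_conj lerDl sumr_ge0 // => g _.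
  by rewrite mulr_ge0.
exists (fun g => Z^-1 *: A g), s; split; split.
- by move=> g; exact: (psdZ iZ0 (pA g)).
- have -> : 1%:M - \sum_g (Z^-1 *: A g) = Z^-1 *: (Z%:M - \sum_g A g).
    by rewrite scalerBr scale_scalar_mx mulVf ?gt_eqF // scaler_sumr.
  by apply: (psdZ iZ0); rewrite eZ; exact: psd_le_trace.
- move=> g; rewrite -scalemxAl -scalemxAr AE; congr (_ *: _).
  by rewrite -mulmxA VH mulmxA -[_ *m T *m _]mulmxA TH mulmxA VHa !mulmxA.
- move=> g h; rewrite -scalemxAr -scalemxAl !AE; congr (_ *: _).
  have [c [c1 e]] := pV g h; rewrite -!VE in e *.
  rewrite !mulmxA -adjM -[_ *m V g *m V h]mulmxA e adjZ -!scalemxAl -scalemxAr scalerA.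
  by rewrite mulrC -normCK c1 expr1n scale1r.
- by rewrite -rc_lt; apply: lt_le_trans n1; rewrite mulr_gt0 ?invr_gt0.
- by under eq_bigr do rewrite trN.
- move=> g bg; rewrite trN rcM.
  apply: (@le_trans _ _ (rc eta * (Z^-1 * \tr (T *m ntensmx rho k0)))).
    rewrite trA mulrCA; apply: (ler_wpM2l iZ0); exact: trTbad.
  by apply: ler_wpM2l n1; rewrite rc_ge0.
Qed.

                                                                              
                                                      
(** Apply [N] to a fresh block and, on failure, fall back on [M]; the failure effect 1 - sum N is
    itself invariant under the group. The error bound follows e |-> |G| eta s + (1 - s) e, whose
    fixed point |G| eta is independent of [s]. *)
Lemma povm_round k0 (N : G -> 'M[C]_(d ^ k0)) (eta s : R) : 0 <= eta -> 0 <= s ->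
  (forall g, psd (N g)) -> psd (1%:M - \sum_g N g) ->
  (forall g, N g *m hamn H k0 = hamn H k0 *m N g) ->
  (forall g h, (ntensmx (U h) k0)^t* *m N g *m ntensmx (U h) k0 = N (g * h)%g) ->
  \sum_g \tr (N g *m ntensmx rho k0) = rc s ->
  (forall g, bad g -> \tr (N g *m ntensmx rho k0) <= rc (eta * s)) ->
  forall k (M : G -> 'M[C]_(d ^ k)) (e : R),
    covariant_povm M -> povm_error M <= rc e -> s <= 1 ->
    exists2 M' : G -> 'M[C]_(d ^ (k0 + k)), covariant_povm M'
      & povm_error M' <= rc (#|G|%:R * eta * s + (1 - s) * e).
Proof.
move=> eta0 s0 pN pF NH Ncov es Nbad k M e [pM sM MH Mcov] Merr s1.
have [_ trk] := density_ntens k0 rho_density.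
have uV h := adj_mul_unitary (ntens_unitary k0 (U_rep.1 h)).
have [F eF] : {F | F = 1%:M - \sum_g N g} by exists (1%:M - \sum_g N g).
rewrite -eF in pF.
have FH : F *m hamn H k0 = hamn H k0 *m F.
  rewrite eF mulmxBl mulmxBr mul1mx mulmx1 mulmx_suml mulmx_sumr.
  by congr (_ - _); apply: eq_bigr => g _; rewrite NH.
have Fcov h : (ntensmx (U h) k0)^t* *m F *m ntensmx (U h) k0 = F.
  rewrite eF mulmxBr mulmxBl mulmx1 uV mulmx_sumr mulmx_suml.
  congr (_ - _); rewrite [RHS](reindex_inj (mulIg h)) /=.
  by apply: eq_bigr => g _; rewrite Ncov.
have trF : \tr (F *m ntensmx rho k0) = rc (1 - s).
  rewrite eF mulmxBl mul1mx trB trk tr_suml es.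
  by rewrite rcB.
exists (fun g => cst (expn_split d k0 k) (N g *t 1%:M + F *t M g)).
  split.
  - move=> g; case: _ / (expn_split d k0 k); rewrite cst_id.
    by apply: psdD; [exact: (psd_tens (pN g) (psd1 _ _))|exact: (psd_tens pF (pM g))].
  - rewrite -(cst_sum _ (expn_split d k0 k)) big_split /= -tensmx_suml -tensmx_sumr sM -tensmxDl.
    by rewrite eF addrC subrK tensmx11 cst1.
  - move=> g; rewrite hamn_split -!cstM; congr cst.
    rewrite mulmxDl !mulmxDr !mulmxDl !tensM !mulmx1 !mul1mx.
    by rewrite NH FH MH addrACA.
  - move=> g h; rewrite ntens_split cst_adj -!cstM; congr cst.
    rewrite adj_tens mulmxDr mulmxDl !tensM mulmx1 Ncov Fcov Mcov.
    by rewrite (adj_mul_unitary (ntens_unitary k (U_rep.1 h))).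
have E g : \tr (cst (expn_split d k0 k) (N g *t 1%:M + F *t M g) *m ntensmx rho (k0 + k)) =
    \tr (N g *m ntensmx rho k0) + rc (1 - s) * \tr (M g *m ntensmx rho k).
  rewrite ntens_split -cstM tr_cst mulmxDl !tensM mul1mx mxtraceD !tr_tens.
  by rewrite (density_ntens k rho_density).2 mulr1 trF.
rewrite /povm_error (eq_bigr _ (fun g _ => E g)) big_split /= -mulr_sumr [rc (_ * _ * s + _)]rcD.
apply: lerD; last by rewrite rcM ler_wpM2l // rc_ge0 subr_ge0.
apply: (@le_trans _ _ (\sum_(g | bad g) rc (eta * s))); first exact: ler_sum.
apply: (le_trans (sum_bad_le _)); first by rewrite rc_ge0 mulr_ge0.
by rewrite -mulrA [rc (#|G|%:R * _)]rcM rc_nat.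
Qed.

(** The separation that makes bad outcomes detectable; for unreachable group elements it is supplied
    by [unreachable_overlap]. *)
Hypothesis bad_overlap : exists2 x : R, rc x < \tr (rho *m rho) & forall g, bad g ->
  forall t, \tr (evol H t rho *m (U g *m rho *m (U g)^t*)) <= rc x.

(** The test of [invariant_test] has ratio at most (k+1)^d (x / tr rho^2)^k, and x < tr rho^2 allows
    a k that makes this at most [eta]. *)
Lemma discriminating_test (eta : R) : 0 < eta -> exists k0 (T : 'M[C]_(d ^ k0)),
  [/\ psd T, T *m hamn H k0 = hamn H k0 *m T,
   0 < \tr (T *m ntensmx rho k0) &
   forall g, bad g -> \tr (T *m ntensmx (U g *m rho *m (U g)^t*) k0) <=
     rc eta * \tr (T *m ntensmx rho k0)].
Proof.
move=> eta0; have [x0 x0P hx0] := bad_overlap.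
have [pr _] := rho_density.
have eP : \tr (rho *m rho) = rc (complex.Re (\tr (rho *m rho))).
  by apply: rc_Re; exact: tr_psdM_ge0.
set P := complex.Re _ in eP.
have P0 : 0 < P.
  rewrite -rc_lt -eP rc0 lt_def (tr_psdM_ge0 pr pr) andbT.
  apply/negP => /eqP trr.
  have r0 : rho = 0.
    have rr : \sum_i \sum_j `|rho i j| ^+ 2 = 0.
      transitivity (\tr (rho *m rho)); last exact: trr.
      rewrite /mxtrace; apply: eq_bigr => i _; rewrite mxE.
      by apply: eq_bigr => j _; rewrite normCK -adjE (psd_adj pr).
    apply/matrixP => i j; rewrite mxE; apply/eqP; rewrite -normr_eq0 -sqrf_eq0.
    have /psumr_eq0P /(_ i isT) := rr.
    move=> /(_ (fun a _ => sumr_ge0 _ (fun b _ => exprn_ge0 2 (normr_ge0 (rho a b))))).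
    by move=> /psumr_eq0P => /(_ (fun b _ => exprn_ge0 2 (normr_ge0 (rho i b))) j isT) ->.
  have := rho_density.2; rewrite r0 mxtrace0 => /esym /eqP.
  by rewrite oner_eq0.
(* [x0] may be negative, for instance when no outcome is bad, while the geometric estimate needs a
   nonnegative ratio. *)
pose x := Num.max x0 0.
have x_ge0 : 0 <= x by rewrite le_max lexx orbT.
have xP : x < P by rewrite gt_max P0 -rc_lt -eP x0P.
have hx g : bad g -> forall t, \tr (evol H t rho *m (U g *m rho *m (U g)^t*)) <= rc x.
  by move=> bg t; apply: (le_trans (hx0 g bg t)); rewrite rc_le le_max lexx.
have [k hk] := @poly_geometric_small R (x / P) d eta (divr_ge0 x_ge0 (ltW P0))
  (ltac:(by rewrite ltr_pdivrMr // mul1r)) eta0.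
have [M [pM MH h1 h2]] := invariant_test k H_herm pr.
exists k, M; split=> //.
  rewrite lt_def (tr_psdM_ge0 pM (density_ntens k rho_density).1) andbT; apply/negP => /eqP e0.
  move: h1; rewrite e0 mulr0 eP -rcX -rc0 rc_le leNgt exprn_gt0 //.
move=> g bg; apply: (le_trans (h2 _ _ (psd_conj (U g) pr) (hx g bg))).
have -> : x ^+ k = (x / P) ^+ k * P ^+ k by rewrite -exprMn divfK // gt_eqF.
have nk0 : 0 < k.+1%:R ^+ d :> R by rewrite exprn_gt0 // ltr0n.
have hk' : (x / P) ^+ k <= eta / k.+1%:R ^+ d by rewrite ler_pdivlMr // mulrC.
apply: (@le_trans _ _ (rc (eta / k.+1%:R ^+ d * P ^+ k))).
  by rewrite rc_le ler_wpM2r // exprn_ge0 // ltW.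
rewrite rcM rcM -mulrA ler_wpM2l ?rc_ge0 ?(ltW eta0) //.
rewrite rcV rcX rc_nat ler_pdivrMl; last by rewrite exprn_gt0 // ltr0n.
by rewrite rcX -eP -natrX.
Qed.

(** Rounds are added until the probability (1 - s)^r that all fail is at most eps/2; the wrong
    answers of successful rounds account for at most |G| eta = eps/2. *)
Lemma povm_exists (eps : R) : 0 < eps -> exists K, forall k, (K <= k)%N ->
  exists2 M : G -> 'M[C]_(d ^ k), covariant_povm M & povm_error M <= rc eps.
Proof.
move=> eps0.
have G0 : 0 < #|G|%:R :> R by rewrite ltr0n; apply/card_gt0P; exists 1%g.
pose eta := eps / 2 / #|G|%:R.
have eta0 : 0 < eta by rewrite !divr_gt0.
have [k0 [T [pT TH trT0 trTbad]]] := discriminating_test eta0.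
have [N [s [[pN pF NH Ncov] [s0 es Nbad]]]] := round_effects (ltW eta0) pT TH trT0 trTbad.
have s1 : s <= 1.
  have := tr_psdM_ge0 pF (density_ntens k0 rho_density).1.
  rewrite mulmxBl mul1mx trB (density_ntens k0 rho_density).2.
  by rewrite tr_suml es -rc1 -rcB rc_ge0 subr_ge0.
have step := povm_round (ltW eta0) (ltW s0) pN pF NH Ncov es Nbad.
have Geta : #|G|%:R * eta = eps / 2 by rewrite /eta mulrC divfK // gt_eqF.
(* The [j] surplus copies carry the uniform measurement used after [r] failures, so every number of
   copies from r * k0 on is covered. *)
have it r j : exists2 M : G -> 'M[C]_(d ^ (r * k0 + j)), covariant_povm M &
    povm_error M <= rc (eps / 2 + (1 - s) ^+ r).
  elim: r => [|r [M cM eM]].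
    have [M cM eM] := trivial_povm (0 * k0 + j); exists M => //.
    by apply: (le_trans eM); rewrite rc_le expr0 lerDr ltW // divr_gt0.
  rewrite mulSn -addnA; have [M' cM' eM'] := step _ M _ cM eM s1; exists M' => //.
  apply: (le_trans eM'); rewrite rc_le Geta exprS.
  by rewrite (_ : _ + _ = eps / 2 + (1 - s) * (1 - s) ^+ r) //; ring.
have [r hr] := @poly_geometric_small R (1 - s) 0 (eps / 2) (ltac:(by rewrite subr_ge0))
  (ltac:(by rewrite ltrBlDr ltrDl)) (ltac:(by rewrite divr_gt0)).
exists (r * k0)%N => k kk; rewrite -(subnKC kk).
have [M cM eM] := it r (k - r * k0)%N; exists M => //.
apply: (le_trans eM); rewrite rc_le.
by rewrite expr0 mul1r in hr; lra.
Qed.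

End Povm.

(** * Closure of the time orbit; continuity of tensor powers and traces *)

Section Orbits.
Variable R : realType.
Local Notation C := (Cx R).

Lemma density_dim_gt0 d (A : 'M[C]_d) : density A -> (0 < d)%N.
Proof.
case: d A => // A [_ /eqP]; by rewrite /mxtrace big_ord0 eq_sym oner_eq0.
Qed.

Lemma tr_conj_unitary (F : numClosedFieldType) n (V A B : 'M[F]_n) : V \is unitarymx ->
  \tr ((V *m A *m V^t*) *m (V *m B *m V^t*)) = \tr (A *m B).
Proof.
move=> uV; rewrite !mulmxA (mulmx_unitaryKV _ uV) trC !mulmxA.
by rewrite adj_mul_unitary // mul1mx.
Qed.

Lemma entry_le_hs (F : numClosedFieldType) n (A : 'M[F]_n) i j :
  A^t* = A -> `|A i j| ^+ 2 <= \tr (A *m A).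
Proof.
move=> hA; have -> : \tr (A *m A) = \sum_a \sum_b `|A a b| ^+ 2.
  rewrite /mxtrace; apply: eq_bigr => a _; rewrite mxE; apply: eq_bigr => b _.
  by rewrite normCK -adjE hA.
rewrite (bigD1 i) //= (bigD1 j) //= -addrA lerDl addr_ge0 // sumr_ge0 // => a _.
by apply: sumr_ge0 => b _; rewrite exprn_ge0.
Qed.

Lemma hs_expand (F : numClosedFieldType) n (A B : 'M[F]_n) :
  \tr ((A - B) *m (A - B)) = \tr (A *m A) + \tr (B *m B) - 2 * \tr (A *m B).
Proof.
rewrite mulmxBl !mulmxBr !trB (trC B A).
by ring.
Qed.

Lemma finite_lower_bound (I : finType) (f : I -> R) : (forall i, 0 < f i) ->
  exists2 e : R, 0 < e & forall i, e <= f i.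
Proof.
move=> f0; suff [e e0 he] : exists2 e : R, 0 < e & forall i, i \in enum I -> e <= f i.
  by exists e => // i; apply: he; rewrite mem_enum.
elim: (enum I) => [|i s [e e0 he]]; first by exists 1.
exists (Num.min e (f i)) => [|j]; first by rewrite lt_min e0 f0.
rewrite inE => /orP[/eqP ->|js]; first by rewrite ge_min lexx orbT.
by rewrite ge_min he.
Qed.

Lemma cvg_tens a b (A : nat -> 'M[C]_a) (B : nat -> 'M[C]_b) (A0 : 'M[C]_a) (B0 : 'M[C]_b) :
  A @ \oo --> A0 -> B @ \oo --> B0 -> (fun j => A j *t B j) @ \oo --> A0 *t B0.
Proof.
move=> hA hB; apply: cvg_mx_entries => i j.
case: (mxtens_indexP i) => i1 i2; case: (mxtens_indexP j) => j1 j2.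
rewrite tensmxE (_ : (fun k => _) = fun k => A k i1 j1 * B k i2 j2); last first.
  by apply/funext => k; rewrite tensmxE.
by apply: cvgM; exact: mx_entries_cvg.
Qed.

Lemma cvg_ntens d (A : nat -> 'M[C]_d) (L : 'M[C]_d) n :
  A @ \oo --> L -> (fun j => ntensmx (A j) n) @ \oo --> ntensmx L n.
Proof.
move=> hA; elim: n => [|n IH]; first exact: cvg_cst.
rewrite ntens_cons (_ : (fun j => _) =
  fun j => cst (expn_cons d n) (A j *t ntensmx (A j) n)); last first.
  by apply/funext => j; rewrite ntens_cons.
case: _ / (expn_cons d n); rewrite cst_id (_ : (fun j => _) = fun j => A j *t ntensmx (A j) n).
  exact: cvg_tens.
by apply/funext => j; rewrite cst_id.
Qed.

Lemma cvg_tr_linear m n (E : {linear 'M[C]_m -> 'M[C]_n}) (B : 'M[C]_n)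
    (X : nat -> 'M[C]_m) (L : 'M[C]_m) :
  X @ \oo --> L -> (fun j => \tr (B *m E (X j))) @ \oo --> \tr (B *m E L).
Proof.
have [f fE] : exists f : {linear 'M[C]_m -> C^o}, forall X, f X = \tr (B *m E X).
  apply: (@ex_linear C _ _ (fun X => \tr (B *m E X) : C^o)) => c Y Z.
  by rewrite linearP mulmxDr -scalemxAr mxtraceD mxtraceZ.
move=> /(@cvg_linear_form _ _ _ _ _ f); rewrite fE.
by rewrite (_ : (fun k => _) = fun j => \tr (B *m E (X j))) //; apply/funext => j; rewrite fE.
Qed.

Lemma cvg_tr m (B : 'M[C]_m) (X : nat -> 'M[C]_m) (L : 'M[C]_m) :
  X @ \oo --> L -> (fun j => \tr (B *m X j)) @ \oo --> \tr (B *m L).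
Proof.
have [f fE] := @ex_linear C 'M[C]_m 'M[C]_m id (fun _ _ _ => erefl).
move=> /(@cvg_tr_linear _ _ f B _ _); rewrite fE.
by rewrite (_ : (fun j => _) = fun j => \tr (B *m X j)) //; apply/funext => j; rewrite fE. Qed.

Lemma contraction_tr_conj n (V B X : 'M[C]_n) : V \is unitarymx -> contraction B ->
  `|\tr (B *m (V *m X *m V^t*))| <= rc (trace_norm X).
Proof.
move=> uV cB; have -> : \tr (B *m (V *m X *m V^t*)) = \tr ((V^t* *m B *m V) *m X).
  by rewrite !mulmxA trC !mulmxA.
exact: contraction_tr_le (contraction_unitary uV cB).
Qed.

Lemma cvg_dist_le (a b : nat -> C) (x y : C) (e : R) : a @ \oo --> x -> b @ \oo --> y ->
  (forall j, `|a j - b j| <= rc e) -> `|x - y| <= rc e.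
Proof.
move=> /cvg_CxP ha /cvg_CxP hb hab.
have [z z0 ez] := normCx_rc (x - y); rewrite ez rc_le.
apply/ler_addgt0Pr => u u0.
have u2 : 0 < u / 2 by rewrite divr_gt0.
have [N hN] := ha _ u2; have [M hM] := hb _ u2; pose j := maxn N M.
have h1 := hN j (leq_maxl _ _); have h2 := hM j (leq_maxr _ _); have h3 := hab j.
rewrite -rc_le -ez.
have -> : x - y = - (a j - x) + (a j - b j) + (b j - y) by ring.
apply: (le_trans (ler_normD _ _)); apply: (@le_trans _ _ (rc (u / 2) + rc e + rc (u / 2))).
  apply: lerD h2; apply: (le_trans (ler_normD _ _)); rewrite normrN; exact: lerD.
by rewrite -!rcD rc_le; lra.
Qed.

Section OneState.
Variables (G : finGroupType) (d : nat) (U : G -> 'M[C]_d) (H rho : 'M[C]_d).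
Hypotheses (U_rep : proj_urep U) (H_herm : H^t* = H) (rho_density : density rho).

(** Both states have purity tr rho^2, so their squared Hilbert-Schmidt distance is twice this
    deficit: U(g) rho U(g)^dagger lies in the closure of the time orbit of rho. In this form the
    negation is directly an overlap bound for all times. *)
Definition reachable (g : G) : Prop := forall e : R, 0 < e -> exists t,
  \tr (rho *m rho) - \tr (evol H t rho *m (U g *m rho *m (U g)^t*)) < rc e.

Lemma reachable_cvg g : reachable g -> exists t : nat -> R,
  (fun j => evol H (t j) rho) @ \oo --> U g *m rho *m (U g)^t*.
Proof.
move=> hg; have hj j : exists t, \tr (rho *m rho) -
    \tr (evol H t rho *m (U g *m rho *m (U g)^t*)) < rc (j.+1%:R^-1).
  by apply: hg; rewrite invr_gt0 ltr0n.
exists (fun j => projT1 (cid (hj j))); apply: cvg_mx_entries => i k.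
apply/cvg_CxP => e e0.
(* A deficit below 1/(j+1) makes the squared distance less than 2/(j+1), which is at most e^2 from
   this index on. *)
exists (Num.truncn (2 / e ^+ 2)) => j Nj; case: (cid (hj j)) => t /= ht.
set L := U g *m rho *m (U g)^t*; rewrite -/L in ht.
have [pr _] := rho_density.
have hD : (evol H t rho - L)^t* = evol H t rho - L.
  by rewrite adjB (psd_adj (psd_evol t H_herm pr)) (psd_adj (psd_conj (U g) pr)).
have -> : evol H t rho i k - L i k = (evol H t rho - L) i k by rewrite !mxE.
rewrite -(@ler_pXn2r _ 2) ?nnegrE ?normr_ge0 ?rc_ge0 ?(ltW e0) //.
apply: (le_trans (entry_le_hs i k hD)); rewrite hs_expand.
have -> : \tr (evol H t rho *m evol H t rho) = \tr (rho *m rho).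
  by rewrite (evolE _ _ H_herm) tr_conj_unitary // prop_unitary.
have -> : \tr (L *m L) = \tr (rho *m rho) by rewrite tr_conj_unitary // U_rep.1.
have -> : \tr (rho *m rho) + \tr (rho *m rho) - 2 * \tr (evol H t rho *m L) =
   2 * (\tr (rho *m rho) - \tr (evol H t rho *m L)) by ring.
apply: (@le_trans _ _ (2 * rc (j.+1%:R^-1))).
  by rewrite ler_wpM2l ?ler0n // ltW.
rewrite -(rc_nat R 2) -rcM -rcX rc_le.
rewrite ler_pdivrMr ?ltr0n // mulrC -ler_pdivrMr ?exprn_gt0 //.
apply: ltW; apply: (lt_le_trans (truncnS_gt _)); rewrite ler_nat ltnS.
exact: Nj.
Qed.

(** Each unreachable g has a gap valid for all times; finiteness of [G] gives a common one. *)
Lemma unreachable_overlap : exists2 x : R, rc x < \tr (rho *m rho) &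
  forall g, ~~ `[<reachable g>] -> forall t,
    \tr (evol H t rho *m (U g *m rho *m (U g)^t*)) <= rc x.
Proof.
have [pr _] := rho_density.
have eP : \tr (rho *m rho) = rc (complex.Re (\tr (rho *m rho))).
  by apply: rc_Re; exact: (tr_psdM_ge0 pr pr).
move: (complex.Re _) eP => P eP.
have hg g : exists e : R, 0 < e /\ (~~ `[<reachable g>] -> forall t,
    \tr (evol H t rho *m (U g *m rho *m (U g)^t*)) <= rc (P - e)).
  have [hg|hg] := pselect (reachable g); first by exists 1; split=> // /asboolP.
  have [e [e0 he]] : exists e : R, 0 < e /\ forall t,
      ~ (\tr (rho *m rho) - \tr (evol H t rho *m (U g *m rho *m (U g)^t*)) < rc e).
    apply: contrapT => hn; apply: hg => e e0; apply: contrapT => ht; apply: hn.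
    by exists e; split=> // t htt; apply: ht; exists t.
  exists e; split=> // _ t; have := he t.
  rewrite eP.
  have -> : \tr (evol H t rho *m (U g *m rho *m (U g)^t*)) =
      rc (complex.Re (\tr (evol H t rho *m (U g *m rho *m (U g)^t*)))).
    apply: rc_Re; exact: (tr_psdM_ge0 (psd_evol t H_herm pr) (psd_conj (U g) pr)).
  rewrite -rcB rc_lt rc_le => /negP; rewrite -leNgt; lra.
have [e e0 he] := finite_lower_bound (fun g => (projT2 (cid (hg g))).1).
exists (P - e); first by rewrite eP rc_lt; lra.
move=> g bg t; apply: (le_trans ((projT2 (cid (hg g))).2 bg t)).
by rewrite rc_le; have := he g; lra.
Qed.

End OneState.
End Orbits.

Arguments cvg_tr_linear {R m n} E B {X L} _.
Arguments cvg_tr {R m} B {X L} _.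
Arguments cvg_ntens {R d A L} n _.

                         

(** * Channels preserve states *)

Section PositiveMaps.
Variable R : realType.
Local Notation C := (Cx R).

Lemma cp_psd m n (E : 'M[C]_m -> 'M[C]_n) X : completely_positive E -> psd X -> psd (E X).
Proof.
move=> cE pX; have := cE 1%N _ (psd_tens (psd1 R 1) pX).
have -> : ampl E ((1%:M : 'M[C]_1) *t X) = (1%:M : 'M[C]_1) *t E X.
  apply: blockP => i j.
  by rewrite block_ampl !block_tens !ord1 mxE eqxx !scale1r.
rewrite (tens1_cst (esym (mul1n n))).
by case: _ / (esym (mul1n n)); rewrite cst_id.
Qed.

Lemma density_channel m n (E : {linear 'M[C]_m -> 'M[C]_n}) X :
  channel E -> density X -> density (E X).
Proof. by move=> [cE tE] [pX tX]; split; [exact: cp_psd pX | rewrite tE]. Qed.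

Lemma psd_cst m n (e : m = n) (A : 'M[C]_m) : psd A -> psd (cst e A).
Proof. by case: _ / e; rewrite cst_id. Qed.

Lemma contraction_cst m n (e : m = n) (B : 'M[C]_m) :
  contraction B -> contraction (cst e B).
Proof. by case: _ / e; rewrite cst_id. Qed.

Lemma dist_detour (a b x y : C) (e : R) : `|a - b| <= rc e -> `|a - x| <= rc e ->
  `|b - y| <= rc e -> `|x - y| <= rc (e + e + e).
Proof.
move=> h h1 h2; have -> : x - y = - (a - x) + (a - b) + (b - y) by ring.
apply: (le_trans (ler_normD _ _)); rewrite !rcD; apply: lerD h2.
by apply: (le_trans (ler_normD _ _)); rewrite normrN; exact: lerD.
Qed.

Lemma ntens_conj (F : numClosedFieldType) d (V A : 'M[F]_d) n :
  ntensmx V n *m ntensmx A n *m (ntensmx V n)^t* = ntensmx (V *m A *m V^t*) n.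
Proof. by rewrite ntens_adj !ntensM. Qed.

End PositiveMaps.

(** * From single operations to achievable rates *)

Section Rates.
Variables (R : realType) (G : finGroupType) (d d' : nat).
Local Notation C := (Cx R).
Variables (U : G -> 'M[C]_d) (U' : G -> 'M[C]_d') (rho : 'M[C]_d) (sigma : 'M[C]_d').
Variables (H : 'M[C]_d) (H' : 'M[C]_d') (beta : R).
Hypotheses (U_rep : proj_urep U) (U'_rep : proj_urep U').
Hypotheses (rho_density : density rho) (sigma_density : density sigma).
Hypotheses (H_herm : H^t* = H) (H'_herm : H'^t* = H').
Hypotheses (U_comm : forall g, U g *m H = H *m U g)
  (U'_comm : forall g, U' g *m H' = H' *m U' g).

Notation error E n m := (trace_norm (E (ntensmx rho n) - ntensmx sigma m)).

(** [E] of the evolved input tends to [E] of the rotated input; covariance moves both actions to the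
    output. One [e] pays for this convergence, and two for replacing the output by copies of [sigma]
    under each action. *)
Lemma covariant_evolution_close n m (E : {linear 'M[C]_(d ^ n) -> 'M[C]_(d' ^ m)})
    (g : G) (t : nat -> R) (B : 'M[C]_(d' ^ m)) (e : R) :
  (forall L t, E (evol (hamn H n) t L) = evol (hamn H' m) t (E L)) ->
  covariant (fun g => ntensmx (U g) n) (fun g => ntensmx (U' g) m) E ->
  (fun j => evol H (t j) rho) @ \oo --> U g *m rho *m (U g)^t* ->
  contraction B -> error E n m <= e -> 0 < e ->
  exists N, forall j, (N <= j)%N ->
    `|\tr (B *m ntensmx (evol H' (t j) sigma) m)
      - \tr (B *m ntensmx (U' g *m sigma *m (U' g)^t*) m)| <= rc (e + e + e).
Proof.
move=> Eev Ecov ht cB err e0.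
have /cvg_CxP /(_ e e0) [N hN] := cvg_tr_linear E B (cvg_ntens n ht).
exists N => j /hN.
rewrite -(evol_hamn _ _ _ H_herm) Eev -(evol_hamn _ _ _ H'_herm).
rewrite !(evolE _ _ (hamn_herm m H'_herm)) -!ntensM -!ntens_adj Ecov.
set W := propagator _ _; set V := ntensmx (U' g) m; set Y := E _; set S := ntensmx sigma m => h.
have uW : W \is unitarymx by apply: prop_unitary; exact: hamn_herm.
have uV : V \is unitarymx by exact: ntens_unitary (U'_rep.1 g).
have D (Z : 'M[C]_(d' ^ m)) : Z \is unitarymx ->
    `|\tr (B *m (Z *m Y *m Z^t*)) - \tr (B *m (Z *m S *m Z^t*))| <= rc e.
  move=> uZ; rewrite -trB -mulmxBr -mulmxBl -mulmxBr.
  by apply: (le_trans (contraction_tr_conj _ uZ cB)); rewrite rc_le.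
have h1 := D W uW; have h2 := D V uV.
exact: (dist_detour h h1 h2).
Qed.

Lemma tr_first_copy (A : 'M[C]_d') (B : 'M[C]_d') m : \tr A = 1 ->
  \tr (cst (expn_cons d' m) (B *t 1%:M) *m ntensmx A m.+1) = \tr (B *m A).
Proof.
move=> trA; rewrite ntens_cons -cstM tr_cst tensM mul1mx tr_tens tr_ntens trA.
by rewrite expr1n mulr1.
Qed.

(** Matrix entries of one copy of [sigma] are tested on the first of the output copies, whose error
    vanishes as n grows; a positive rate guarantees that there is such a copy. *)
Lemma achievable_compatible (r : R) : 0 < r ->
  achievable (cov_tcgp_class beta H H' U U') rho sigma r ->
  compatible H H' U U' rho sigma.
Proof.
move=> r0 [_ [E [cE errE]]] g t ht; apply: cvg_mx_entries => a b.
apply/cvg_CxP => e e0.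
(* The rate measures half the trace norm, so the trace norm is at most e/3, and
   [covariant_evolution_close] spends it three times. *)
have e6 : 0 < e / 6 by rewrite divr_gt0.
move/cvgrPdist_le: errE => /(_ _ e6) [N0 _ hN0].
(* Beyond 1/r inputs the output has at least one copy. *)
pose n := maxn N0 (Num.truncn r^-1).+1.
have := hN0 n (leq_maxl _ _); have [[_ _ Eev] Ecov] := cE n.
have : (0 < Num.truncn (r * n%:R))%N.
  rewrite truncn_gt_nat -ler_pdivrMl // mulr1.
  apply: ltW; apply: (lt_le_trans (truncnS_gt _)); rewrite ler_nat; exact: leq_maxr.
move: (E n) Eev Ecov; case: (Num.truncn _) => // m F Eev Ecov _.
rewrite /= sub0r normrN ger0_norm; last by rewrite mulr_ge0 ?invr_ge0 ?trace_norm_ge0.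
move=> err; have {}err : error F n m.+1 <= e / 3 by lra.
have e3 : 0 < e / 3 by rewrite divr_gt0.
have cB : contraction (cst (expn_cons d' m) ((delta_mx b a : 'M[C]_d') *t 1%:M)).
  by apply: contraction_cst; apply: contraction_tens1r; exact: contraction_delta.
have [N hN] := covariant_evolution_close Eev Ecov ht cB err e3.
exists N => j /hN; rewrite !tr_first_copy.
- by rewrite !tr_mul_delta (_ : e / 3 + e / 3 + e / 3 = e) //; lra.
- rewrite trC mulmxA adj_mul_unitary ?(U'_rep.1 g) // mul1mx.
  exact: sigma_density.2.
- rewrite (evolE _ _ H'_herm) trC mulmxA adj_mul_unitary ?mul1mx; first exact: sigma_density.2.
  exact: prop_unitary.
Qed.

Definition discard_copies q m (Y : 'M[C]_(d' ^ (q + m))) : 'M[C]_(d' ^ m) :=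
  pt 1%:M (cst (esym (expn_split d' q m)) Y).

Lemma cst_esym m n (e : m = n) (A : 'M[C]_n) : cst e (cst (esym e) A) = A.
Proof. by move: A; case: _ / e => A; rewrite !cst_id. Qed.

Lemma tr_drop q m (B : 'M[C]_(d' ^ m)) Y :
  \tr (B *m discard_copies Y) = \tr (cst (expn_split d' q m) (1%:M *t B) *m Y).
Proof.
by rewrite tr_pt -[Y in RHS](cst_esym (expn_split d' q m)) -cstM tr_cst.
Qed.

Lemma drop_ntens q m (A : 'M[C]_d') : \tr A = 1 ->
  discard_copies (ntensmx A (q + m)) = ntensmx A m :> 'M[C]_(d' ^ m).
Proof.
move=> trA; rewrite /discard_copies ntens_split (cst_comp _ _ (erefl _)) cst_id pt_tens mul1mx.
by rewrite tr_ntens trA expr1n scale1r.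
Qed.

(** [twirled_channel] with k measured copies, l converted ones and q discarded outputs. Measured and
    converted copies are independent, so the output is a mixture weighted by the outcome
    probabilities. *)
Lemma twirled_copies k l q m (M : G -> 'M[C]_(d ^ k))
    (E : {linear 'M[C]_(d ^ l) -> 'M[C]_(d' ^ (q + m))}) :
  covariant_povm U H M -> tcgp beta (hamn H l) (hamn H' (q + m)) E ->
  exists E' : {linear 'M[C]_(d ^ (k + l)) -> 'M[C]_(d' ^ m)},
    cov_tcgp_class beta H H' U U' E' /\
    E' (ntensmx rho (k + l)) = \sum_g \tr (M g *m ntensmx rho k) *:
      ((ntensmx (U' g) m)^t* *m discard_copies (E (ntensmx (U g *m rho *m (U g)^t*) l))
        *m ntensmx (U' g) m).
Proof.
move=> [pM sM MH Mcov].
have dk n : (0 < d ^ n)%N by rewrite expn_gt0 (density_dim_gt0 rho_density).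
have d'k n : (0 < d' ^ n)%N by rewrite expn_gt0 (density_dim_gt0 sigma_density).
rewrite /discard_copies hamn_split => tE.
have [F FE] : exists F : {linear 'M[C]_(d ^ l) -> 'M[C]_(d' ^ q * d' ^ m)},
    tcgp beta (hamn H l) (hamn H' q *t 1%:M + 1%:M *t hamn H' m) F /\
    forall X, F X = cst (esym (expn_split d' q m)) (E X).
  move: E tE; case: _ / (expn_split d' q m) => E; rewrite cst_id => tE.
  by exists E; split=> // X; rewrite cst_id.
have [tF FEE] := FE.
have [F' [tF' cF' F'E]] := twirled_channel (dk k) (d'k q)
  (hamn_herm k H_herm) (hamn_herm l H_herm) (hamn_herm q H'_herm) (hamn_herm m H'_herm)
  (proj_urep_ntens k U_rep) (proj_urep_ntens l U_rep) (proj_urep_ntens m U'_rep)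
  (fun g => hamn_comm l (U_comm g)) (fun g => hamn_comm m (U'_comm g))
  pM sM MH Mcov tF.
have [E' [tE' cE' E'E]] : exists E' : {linear 'M[C]_(d ^ (k + l)) -> 'M[C]_(d' ^ m)},
    [/\ tcgp beta (cst (expn_split d k l) (hamn H k *t 1%:M + 1%:M *t hamn H l)) (hamn H' m) E',
      covariant (fun g => cst (expn_split d k l) (ntensmx (U g) k *t ntensmx (U g) l))
         (fun g => ntensmx (U' g) m) E'
     & forall X, E' (cst (expn_split d k l) X) = F' X].
  by case: _ / (expn_split d k l); exists F'; rewrite cst_id; split.
exists E'; split.
  split; first by rewrite hamn_split.
  by move=> g X; rewrite ntens_split; exact: cE'.
rewrite ntens_split E'E F'E; apply: eq_bigr => g _.
rewrite pt_tens -scalemxAr -scalemxAl linearZ /= ptZ -scalemxAr -scalemxAl.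
by rewrite ntens_conj FEE.
Qed.

(** Along the times t_j, [E] of the translated input is the translate of its output, whose distance
    to the translated copies of [sigma] is at most the error. The inputs tend to copies of U(g) rho
    U(g)^dagger and, by compatibility, the targets to copies of U'(g) sigma U'(g)^dagger; the bound
    passes to the limit. *)
Lemma reachable_branch_close l q m (E : {linear 'M[C]_(d ^ l) -> 'M[C]_(d' ^ (q + m))})
    (g : G) (B : 'M[C]_(d' ^ m)) :
  compatible H H' U U' rho sigma -> reachable U H rho g ->
  tcgp beta (hamn H l) (hamn H' (q + m)) E -> contraction B ->
  `|\tr (B *m ((ntensmx (U' g) m)^t* *m discard_copies (E (ntensmx (U g *m rho *m (U g)^t*) l))
        *m ntensmx (U' g) m)) - \tr (B *m ntensmx sigma m)| <= rc (error E l (q + m)).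
Proof.
move=> cmp /(reachable_cvg U_rep H_herm rho_density) [t ht] [_ _ Eev] cB.
have ht' := cmp g t ht.
have uV := ntens_unitary m (U'_rep.1 g); set V := ntensmx (U' g) m in uV *.
have uVa : V^t* \is unitarymx by rewrite trmxC_unitary.
have cB1 := contraction_unitary uVa cB; rewrite trmxCK in cB1.
have cB2 : contraction (cst (expn_split d' q m) (1%:M *t (V *m B *m V^t*))).
  by apply: contraction_cst; exact: contraction_tens1l.
(* [B2] is the test [B] pulled back through the final rotation and the discarding of copies; it is
   still a contraction. *)
set B2 := cst _ _ in cB2.
have -> X : \tr (B *m (V^t* *m discard_copies X *m V)) = \tr (B2 *m X).
  by rewrite -tr_drop -[in RHS]mulmxA -[in RHS]mulmxA [RHS]trC !mulmxA.
have -> : \tr (B *m ntensmx sigma m) =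
    \tr (B2 *m ntensmx (U' g *m sigma *m (U' g)^t*) (q + m)).
  rewrite -tr_drop drop_ntens.
    by rewrite -ntens_conj -/V (tr_conj_unitary _ _ uV).
  by rewrite trC mulmxA adj_mul_unitary ?(U'_rep.1 g) // mul1mx sigma_density.2.
apply: (cvg_dist_le (cvg_tr_linear E B2 (cvg_ntens l ht)) (cvg_tr B2 (cvg_ntens (q + m) ht'))).
move=> j; rewrite -(evol_hamn _ _ _ H_herm) Eev -(evol_hamn _ _ _ H'_herm).
rewrite !(evolE _ _ (hamn_herm (q + m) H'_herm)).
rewrite -trB -mulmxBr -mulmxBl -mulmxBr; apply: contraction_tr_conj cB2.
by apply: prop_unitary; exact: hamn_herm.
Qed.

(** Against a contraction two states differ by at most 2, which bounds the unreachable outcomes by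
    twice their probability; every other branch has error at most that of [E]. *)
Lemma twirled_error k l q m (M : G -> 'M[C]_(d ^ k))
    (E : {linear 'M[C]_(d ^ l) -> 'M[C]_(d' ^ (q + m))}) (e1 e2 : R) :
  compatible H H' U U' rho sigma ->
  covariant_povm U H M -> tcgp beta (hamn H l) (hamn H' (q + m)) E ->
  povm_error rho (fun g => ~~ `[<reachable U H rho g>]) M <= rc e1 ->
  error E l (q + m) <= e2 ->
  exists2 E' : {linear 'M[C]_(d ^ (k + l)) -> 'M[C]_(d' ^ m)},
    cov_tcgp_class beta H H' U U' E' & error E' (k + l)%N m <= 2 * e1 + e2.
Proof.
move=> cmp cM tE err1 err2; have [E' [cE' E'E]] := twirled_copies cM tE.
exists E' => //; apply: trace_norm_le => B cB.
have [pM sM _ _] := cM.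
have [prk trk] := density_ntens k rho_density.
have [tau tauE] : {tau : G -> 'M[C]_(d' ^ m) | forall g, tau g = (ntensmx (U' g) m)^t* *m
    discard_copies (E (ntensmx (U g *m rho *m (U g)^t*) l)) *m ntensmx (U' g) m} by eexists.
have [p pE] : {p | forall g, p g = \tr (M g *m ntensmx rho k)} by eexists.
have {}E'E : E' (ntensmx rho (k + l)) = \sum_g p g *: tau g.
  by rewrite E'E; apply: eq_bigr => g _; rewrite tauE pE.
rewrite E'E.
have p0 g : 0 <= p g by rewrite pE; exact: (tr_psdM_ge0 (pM g) prk).
have sp : \sum_g p g = 1 by under eq_bigr do rewrite pE; rewrite -tr_suml sM mul1mx.
have tauD g : density (tau g).
  have dE : density (E (ntensmx (U g *m rho *m (U g)^t*) l)).
    have [chE _ _] := tE; apply: (density_channel chE); apply: density_ntens.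
    split; first exact: (psd_conj (U g) rho_density.1).
    rewrite trC mulmxA adj_mul_unitary ?(U_rep.1 g) // mul1mx; exact: rho_density.2.
  have uV := ntens_unitary m (U'_rep.1 g).
  rewrite tauE; split.
    rewrite -{2}[ntensmx (U' g) m]trmxCK; apply: psd_conj.
    exact: (cp_psd (cp_pt (psd1 R (d' ^ q))) (psd_cst _ dE.1)).
  rewrite trC mulmxA mul_adj_unitary // mul1mx tr_pt1 tr_cst; exact: dE.2.
have dS := density_ntens m sigma_density.
have -> : \tr (B *m (\sum_g p g *: tau g - ntensmx sigma m)) =
    \sum_g p g * (\tr (B *m tau g) - \tr (B *m ntensmx sigma m)).
  rewrite mulmxBr trB mulmx_sumr raddf_sum /=.
  rewrite -[X in _ - X]mul1r -sp mulr_suml -sumrB; apply: eq_bigr => g _.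
  by rewrite -scalemxAr mxtraceZ mulrBr.
apply: (le_trans (ler_norm_sum _ _ _)).
rewrite (bigID (fun g => ~~ `[<reachable U H rho g>])) /= rcD; apply: lerD.
  apply: (@le_trans _ _ (\sum_(g | ~~ `[<reachable U H rho g>]) 2 * p g)).
    apply: ler_sum => g _; rewrite normrM (ger0_norm (p0 g)) mulrC ler_wpM2r //.
    apply: (le_trans (ler_normB _ _)); rewrite -[2]/(1 + 1).
    by apply: lerD; apply: contraction_tr_density.
  rewrite -mulr_sumr rcM rc_nat ler_wpM2l //.
  by under eq_bigr do rewrite pE.
apply: (@le_trans _ _ (\sum_(g | ~~ ~~ `[<reachable U H rho g>]) p g * rc e2)).
  apply: ler_sum => g; rewrite negbK => /asboolP rg.
  rewrite normrM (ger0_norm (p0 g)) ler_wpM2l //.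
  by rewrite tauE; apply: (le_trans (reachable_branch_close cmp rg tE cB)); rewrite rc_le.
rewrite -mulr_suml ler_piMl //; first by rewrite rc_ge0 (le_trans (trace_norm_ge0 _) err2).
by rewrite -sp [leRHS](bigID (fun g => ~~ `[<reachable U H rho g>])) /= lerDr sumr_ge0.
Qed.

Lemma achievable0 : achievable (cov_tcgp_class beta H H' U U') rho sigma 0.
Proof.
have dk n : (0 < d ^ n)%N by rewrite expn_gt0 (density_dim_gt0 rho_density).
have d'k n : (0 < d' ^ n)%N by rewrite expn_gt0 (density_dim_gt0 sigma_density).
have trivial_output m : m = 0%N -> trace_norm (gibbs beta (hamn H' m) - ntensmx sigma m) = 0.
  move=> ->; have [_ tG] := density_gibbs beta (d'k 0%N) (hamn_herm 0 H'_herm).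
  have [_ tS] := density_ntens 0 sigma_density.
  (* With no output copy the dimension is [d' ^ 0 = 1], and trace 1 determines the matrix. *)
  have -> : gibbs beta (hamn H' 0) - ntensmx sigma 0 = 0.
    apply/matrixP => i j; rewrite !ord1 [LHS]mxE [X in _ + X]mxE [RHS]mxE.
    by move: tS tG; rewrite /mxtrace !big_ord1 => -> ->; rewrite subrr.
  apply/eqP; rewrite eq_le trace_norm_ge0 andbT.
  by apply: trace_norm_le => B _; rewrite mulmx0 mxtrace0 normr0 rc0.
split=> //.
have hE n m := discard_channel beta (dk n) (d'k m) (hamn_herm n H_herm) (hamn_herm m H'_herm)
  (proj_urep_ntens n U_rep) (proj_urep_ntens m U'_rep) (fun g => hamn_comm m (U'_comm g)).
exists (fun n => projT1 (cid (hE n (Num.truncn (0 * n%:R))))); split=> [n|].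
  by case: (cid _) => E [? ? ?].
rewrite (_ : (fun n => _) = fun=> 0); [exact: cvg_cst | apply/funext => n].
case: (cid _) => E /= [_ _ EE].
rewrite EE (density_ntens n rho_density).2 scale1r.
by rewrite trivial_output ?mulr0 // mul0r truncn0.
Qed.

(** Of the n inputs, l (just above (r'/r) n) are converted and k = n - l are measured. Then r l >=
    r' n, so the protocol yields enough outputs, while k grows linearly and exceeds the number
    required by [povm_exists]. *)
Lemma eventually_close (r r' : R) (e : R) :
  compatible H H' U U' rho sigma -> 0 < r' -> r' < r -> 0 < e ->
  achievable (tcgp_class beta H H') rho sigma r ->
  exists N, forall n, (N <= n)%N ->
   exists2 E : {linear 'M[C]_(d ^ n) -> 'M[C]_(d' ^ (Num.truncn (r' * n%:R)))},
     cov_tcgp_class beta H H' U U' E & error E n (Num.truncn (r' * n%:R)) <= e.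
Proof.
move=> cmp r'0 r'r e0 [_ [E [tE /cvgrPdist_le errE]]].
have r0 : 0 < r by exact: lt_trans r'r.
(* The trace norm is twice the tracked error and bad outcomes count twice: 2 (e/4) + 2 (e/4) = e. *)
have e4 : 0 < e / 4 by rewrite divr_gt0.
have [N1 _ hN1] := errE _ e4.
have [K hK] := povm_exists U_rep H_herm rho_density U_comm
  (unreachable_overlap U H_herm rho_density) e4.
pose c := r' / r.
have c0 : 0 < c by rewrite divr_gt0.
have c1 : c < 1 by rewrite ltr_pdivrMr // mul1r.
(* The first bound makes l at least [N1]; the second leaves [K] copies to measure even after
   rounding l up. *)
exists (maxn (Num.truncn (N1%:R / c)).+1 (Num.truncn (K.+1%:R / (1 - c))).+1) => n.
rewrite geq_max => /andP[n1 n2].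
have hn1 : N1%:R < c * n%:R.
  rewrite mulrC -ltr_pdivrMr //; apply: (lt_le_trans (truncnS_gt _)).
  by rewrite ler_nat.
have hn2 : K.+1%:R < (1 - c) * n%:R.
  rewrite mulrC -ltr_pdivrMr ?subr_gt0 //; apply: (lt_le_trans (truncnS_gt _)).
  by rewrite ler_nat.
have cn0 : 0 <= c * n%:R by rewrite mulr_ge0 // ltW.
pose l := (Num.truncn (c * n%:R)).+1.
have l1 : c * n%:R < l%:R by exact: truncnS_gt.
have l2 : l%:R <= c * n%:R + 1.
  by rewrite /l -natr1 lerD2r truncn_le.
have kl : (K + l <= n)%N.
  by rewrite -(ler_nat R) natrD; move: hn2; rewrite -natr1; lra.
have N1l : (N1 <= l)%N by rewrite -(ler_nat R) ltW // (lt_trans hn1).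
have [k nE Kk] : exists2 k, n = (k + l)%N & (K <= k)%N.
  exists (n - l)%N; first by rewrite subnK // (leq_trans _ kl) // leq_addl.
  by rewrite leq_subRL ?(leq_trans _ kl) ?leq_addl // addnC.
have mQ : (Num.truncn (r' * n%:R) <= Num.truncn (r * l%:R))%N.
  apply: le_truncn; have -> : r' * n%:R = r * (c * n%:R).
    by rewrite /c mulrA [r * _]mulrC divfK // gt_eqF.
  by apply: ler_wpM2l; exact: ltW.
have := hN1 l N1l; have := tE l; move: (E l).
have [q Qe] : exists q, Num.truncn (r * l%:R) = (q + Num.truncn (r' * n%:R))%N.
  by exists (Num.truncn (r * l%:R) - Num.truncn (r' * n%:R))%N; rewrite subnK.
rewrite {}Qe; move: (Num.truncn (r' * n%:R)) => m F tF /=.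
rewrite sub0r normrN ger0_norm; last by rewrite mulr_ge0 ?invr_ge0 ?trace_norm_ge0.
move=> err; rewrite {}nE.
have [M cM errM] := hK k Kk.
have err' : error F l (q + m)%N <= e / 2 by lra.
have [E' cE' errE'] := twirled_error cmp cM tF errM err'.
by exists E' => //; apply: (le_trans errE'); lra.
Qed.

(** [eventually_close] gives an operation for each tolerance separately. Taking for each n one
    within 1/(n+1) of the least possible error yields a single sequence that serves all
    tolerances. *)
Lemma achievable_lt (r r' : R) :
  compatible H H' U U' rho sigma -> 0 < r' -> r' < r ->
  achievable (tcgp_class beta H H') rho sigma r ->
  achievable (cov_tcgp_class beta H H' U U') rho sigma r'.
Proof.
move=> cmp r'0 r'r ach; split; first exact: ltW.
have dk n : (0 < d ^ n)%N by rewrite expn_gt0 (density_dim_gt0 rho_density).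
have d'k n : (0 < d' ^ n)%N by rewrite expn_gt0 (density_dim_gt0 sigma_density).
pose m n := Num.truncn (r' * n%:R).
pose errors n : set R := [set x | exists2 E : {linear 'M[C]_(d ^ n) -> 'M[C]_(d' ^ m n)},
  cov_tcgp_class beta H H' U U' E & x = error E n (m n)].
have errors_inf n : has_inf (errors n).
  split; last by exists 0 => x [E _ ->]; exact: trace_norm_ge0.
  have [E [tE cE _]] := discard_channel beta (dk n) (d'k (m n)) (hamn_herm n H_herm)
    (hamn_herm (m n) H'_herm) (proj_urep_ntens n U_rep) (proj_urep_ntens (m n) U'_rep)
    (fun g => hamn_comm (m n) (U'_comm g)).
  by exists (error E n (m n)); exists E.
have hE n : exists E : {linear 'M[C]_(d ^ n) -> 'M[C]_(d' ^ m n)},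
    cov_tcgp_class beta H H' U U' E /\ error E n (m n) < inf (errors n) + n.+1%:R^-1.
  have n0 : 0 < n.+1%:R^-1 :> R by rewrite invr_gt0 ltr0n.
  by have [x [E cE ->] hx] := inf_adherent n0 (errors_inf n); exists E.
exists (fun n => projT1 (cid (hE n))); split=> [n|].
  by case: (cid (hE n)) => E [].
apply/cvgrPdist_le => e e0.
have e2 : 0 < e / 2 by rewrite divr_gt0.
have [N hN] := eventually_close cmp r'0 r'r e2 ach.
exists (maxn N (Num.truncn (2 / e)).+1) => // n /=; rewrite geq_max => /andP[Nn en].
case: (cid (hE n)) => E /= [cE errE].
rewrite sub0r normrN ger0_norm; last by rewrite mulr_ge0 ?invr_ge0 ?trace_norm_ge0.
have [F cF errF] := hN n Nn.
have h1 : inf (errors n) <= error F n (m n).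
  by apply: ge_inf; [exact: (errors_inf n).2 | exists F].
have h2 : n.+1%:R^-1 <= e / 2.
  rewrite -[e / 2]invrK lef_pV2 ?posrE ?invr_gt0 ?ltr0n // invf_div.
  apply: ltW; apply: (lt_le_trans (truncnS_gt _)); rewrite ler_nat.
  exact: leqW.
apply: (@le_trans _ _ (error E n (m n))).
  by rewrite ler_piMl ?trace_norm_ge0 // invf_le1 // ler1n.
apply: ltW; apply: (lt_le_trans errE); rewrite [leRHS]splitr.
exact: lerD (le_trans h1 errF) h2.
Qed.

End Rates.

(** * Assembly of the two cases *)

Theorem theorem11 (R : realType) (G : finGroupType) (d d' : nat)
    (U : G -> 'M[Cx R]_d) (U' : G -> 'M[Cx R]_d')
    (rho : 'M[Cx R]_d) (sigma : 'M[Cx R]_d')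
    (H : 'M[Cx R]_d) (H' : 'M[Cx R]_d') (beta : R) :
  proj_urep U -> proj_urep U' ->
  density rho -> density sigma ->
  H \is hermsymmx -> H' \is hermsymmx ->
  (forall g, U g *m H = H *m U g) ->
  (forall g, U' g *m H' = H' *m U' g) ->
  0 < beta ->
  (compatible H H' U U' rho sigma ->
     rate (cov_tcgp_class beta H H' U U') rho sigma =
     rate (tcgp_class beta H H') rho sigma) /\
  (~ compatible H H' U U' rho sigma ->
     rate (cov_tcgp_class beta H H' U U') rho sigma = 0%E).
Proof.
move=> U_rep U'_rep rhoD sigmaD; rewrite !herm_adj => /eqP hH /eqP hH' UH U'H _.
have ach0 := achievable0 beta U_rep U'_rep rhoD sigmaD hH hH' U'H.
have rate0 : (0 <= rate (cov_tcgp_class beta H H' U U') rho sigma)%E.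
  by apply: ereal_sup_ubound; exists 0.
split=> cmp.
  apply/eqP; rewrite eq_le; apply/andP; split.
    apply: ge_ereal_sup => _ [r [r0 [E [cE errE]]] <-]; apply: ereal_sup_ubound.
    by exists r => //; split=> //; exists E; split=> // n; have [] := cE n.
  apply: ge_ereal_sup => _ [r ach <-]; rewrite leNgt; apply/negP.
  move: rate0; case eS: (rate _ _ _) => [s| |] //; rewrite lee_fin lte_fin => s0 sr.
  (* If the covariant rate [s] were below an achievable [r], the midpoint, positive because s >= 0,
     would be covariantly achievable and exceed [s]. *)
  have : (((s + r) / 2)%:E <= rate (cov_tcgp_class beta H H' U U') rho sigma)%E.
    apply: ereal_sup_ubound; exists ((s + r) / 2) => //.
    by apply: (achievable_lt U_rep U'_rep rhoD sigmaD hH hH' UH U'H cmp _ _ ach); lra.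
  by rewrite eS lee_fin; lra.
apply/eqP; rewrite eq_le rate0 andbT; apply: ge_ereal_sup => _ [r ach <-].
rewrite lee_fin leNgt; apply/negP => r0; apply: cmp.
exact: (achievable_compatible U'_rep sigmaD hH hH' r0 ach).
Qed.
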